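(* Let $G(z)=\sum_{p=0}^{d}z^pA_p+\sum_{j=1}^k w_j(z)E_j$, with $d\ge1$, be an $n\times n$ T-palindromic rational matrix polynomial and let $\lambda\in\mathbb{C}\setminus\{0,\pm1\}$ be such that $\lambda$ is not a pole of $G(z)$ and $w_j(\lambda)\ne0$ for $j=1,\ldots,k$. Suppose that $M:=(G(\lambda))^{-1}$ exists. Let $m:=\lfloor\frac{d-1}{2}\rfloor$, let $J$ (Hermitian) and $S_0,\ldots,S_m$ (symmetric) be the matrices of size $n(d+k+1)$ built from $M$, $\lambda$ and the $w_j(\lambda)$ as defined in the context, and define $\psi:\mathbb{R}^{2m+1}\to\mathbb{R}$ by $\psi(t_0,\ldots,t_{2m}):=\lambda_2(F(t_0,\ldots,t_{2m}))$, where $$F(t_0,\ldots,t_{2m}):=\begin{bmatrix}J&\overline{f}\\ f&\overline{J}\end{bmatrix},\qquad f:=(t_0+it_1)S_0+\cdots+(t_{2m-2}+it_{2m-1})S_{m-1}+t_{2m}S_m.$$ Then: (1) The function $\psi$ has a global minimum $\widehat\lambda_2:=\min_{(t_0,\ldots,t_{2m})\in\mathbb{R}^{2m+1}}\psi(t_0,\ldots,t_{2m})$, and $\eta^{\mathrm{pal}_T}(G,\lambda)\ge\frac{1}{\sqrt{\widehat\lambda_2}}$. (2) Moreover, if the minimum $\widehat\lambda_2$ of $\psi$ is attained at $(\hat t_0,\ldots,\hat t_{2m})\in\mathbb{R}^{2m+1}$ and is a simple eigenvalue of $F(\hat t_0,\ldots,\hat t_{2m})$, then $\eta^{\mathrm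{pal}_T}(G,\lambda)=\frac{1}{\sqrt{\widehat\lambda_2}}$.
   Context: A rational matrix polynomial (RMP) is $G(z)=\sum_{p=0}^d z^pA_p+\sum_{j=1}^k w_j(z)E_j$ with $A_p,E_j\in\mathbb{C}^{n\times n}$ and $w_j(z)=s_j(z)/q_j(z)$, where $s_j,q_j$ are scalar polynomials, $q_j\not\equiv0$. The poles of $G(z)$ are the roots of the $q_j$. $G(z)$ is T-palindromic if $A_p^T=A_{d-p}$ for $p=0,\ldots,d$, $E_j^T=E_j$ and $w_j(z)=z^dw_j(1/z)$ for $j=1,\ldots,k$. $\|\cdot\|$ is the spectral norm. For a tuple of $n\times n$ matrices, the tuple norm is $$|||(\Delta A_0,\ldots,\Delta A_d,\Delta E_1,\ldots,\Delta E_k)|||:=\sqrt{\textstyle\sum_{p=0}^d\|\Delta A_p\|^2+\sum_{j=1}^k\|\Delta E_j\|^2}.$$ For $\mathbb{S}\subseteq(\mathbb{C}^{n\times n})^{d+k+1}$ the structured eigenvalue backward error $\eta^{\mathbb{S}}(G,\lambda)$ is the infimum of $|||(\Delta A_0,\ldots,\Delta E_k)|||$ over all $(\Delta A_0,\ldots,\Delta A_d,\Delta E_1,\ldots,\Delta E_k)\in\mathbb{S}$ with $$\det\Big(\sum_{p=0}^d\lambda^p(A_p-\Delta A_p)+\sum_{j=1}^kw_j(\lambda)(E_j-\Delta E_j)\Big)=0.$$ $\eta^{\mathrm{pal}_T}(G,\lambda)$ denotes $\eta^{\mathbb{S}}(G,\lambda)$ when $\mathbb{S}$ is the set of tuples with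 $(\Delta A_p)^T=\Delta A_{d-p}$ for $p=0,\ldots,d$ and $\Delta E_j^T=\Delta E_j$ for $j=1,\ldots,k$. Definition of $J$ and $S_p$. Let $\Lambda:=[1,\lambda,\ldots,\lambda^d,w_1(\lambda),\ldots,w_k(\lambda)]\in\mathbb{C}^{1\times(d+k+1)}$ and let $e_i$ be the $i$th standard unit vector of $\mathbb{R}^{d+k+1}$. For $j=0,\ldots,m$, with $m=\lfloor\frac{d-1}{2}\rfloor$, let $$\gamma_{j1}:=\sqrt{\tfrac{2}{1+|\lambda|^{d-2j}}},\qquad \gamma_{j2}:=\sqrt{\tfrac{2|\lambda|^{d-2j}}{1+|\lambda|^{d-2j}}}.$$ Let $\Gamma:=\mathrm{diag}(\gamma_{01},\ldots,\gamma_{m1},\gamma_{m2},\ldots,\gamma_{02},1,\ldots,1)\otimes I_n$ if $d$ is odd and $\Gamma:=\mathrm{diag}(\gamma_{01},\ldots,\gamma_{m1},1,\gamma_{m2},\ldots,\gamma_{02},1,\ldots,1)\otimes I_n$ if $d$ is even, where the final block of ones has length $k$. Set $$J:=\Gamma^{-1}\big((\Lambda^*\Lambda)\otimes(M^*M)\big)\Gamma^{-1},$$ and, for $p=0,\ldots,m$, $$\widetilde C_p:=\Lambda^Te_{p+1}^T\otimes M^T-e_{d-p+1}\Lambda\otimes M,\qquad S_p:=\Gamma^{-1}(\widetilde C_p+\widetilde C_p^T)\Gamma^{-1}.$$ $\lambda_2(H)$ is the second largest eigenvalue (counted with multiplicity) of a Hermitian matrix $H$; $\overline{X}$ is the entrywise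 complex conjugate; $\otimes$ is the Kronecker product. *)

(* Defs.v *)
From mathcomp Require Import all_boot all_order all_algebra.
From mathcomp Require Import boolp classical_sets reals constructive_ereal ereal.
From mathcomp Require Import complex mxtens.

Set Implicit Arguments.
Unset Strict Implicit.
Unset Printing Implicit Defensive.

Import Order.TTheory GRing.Theory Num.Theory.
Local Open Scope ring_scope.
Local Open Scope complex_scope.
Local Open Scope classical_set_scope.

Section Norms.
Variable R : realType.

Definition vnorm2 (n : nat) (x : 'cV[R[i]]_n) : R :=
  Num.sqrt (\sum_i Normc.normc (x i 0) ^+ 2).

Definition spectral_norm (n : nat) (A : 'M[R[i]]_n) : R :=
  sup [set vnorm2 (A *m x) | x in [set x : 'cV[R[i]]_n | vnorm2 x <= 1]].

Definition conj_mx (m n : nat) (A : 'M[R[i]]_(m, n)) : 'M[R[i]]_(m, n) :=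
  map_mx Num.conj A.

Definition adj_mx (m n : nat) (A : 'M[R[i]]_(m, n)) : 'M[R[i]]_(n, m) :=
  (conj_mx A)^T.

(* Eigenvalues with algebraic multiplicity: the roots of the characteristic
   polynomial, in unspecified order. *)
Definition eigenvalues (N : nat) (H : 'M[R[i]]_N) : seq R[i] :=
  sval (closed_field_poly_normal (char_poly H)).

(* Meant for Hermitian H, whose eigenvalues are real, with 2 <= N. *)
Definition lambda2 (N : nat) (H : 'M[R[i]]_N) : R :=
  nth 0 (sort (>=%R) [seq complex.Re z | z <- eigenvalues H]) 1.

Definition simple_eigenvalue (N : nat) (H : 'M[R[i]]_N) (a : R[i]) : Prop :=
  count_mem a (eigenvalues H) = 1%N.

End Norms.

Section RationalMatrixPolynomial.
Variables (R : realType) (n d k : nat).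

(* The weights w_j = s_j / q_j are kept as given quotients, since the poles are
   the roots of the given q_j. *)
Record rmp := Rmp {
  rA : 'I_d.+1 -> 'M[R[i]]_n;
  rE : 'I_k -> 'M[R[i]]_n;
  rs : 'I_k -> {poly R[i]};
  rq : 'I_k -> {poly R[i]};
  rq_neq0 : forall j, rq j != 0
}.

Variable G : rmp.

Definition weight (j : 'I_k) (z : R[i]) : R[i] := (rs G j).[z] / (rq G j).[z].

Definition rmp_eval (z : R[i]) : 'M[R[i]]_n :=
  \sum_(p < d.+1) z ^+ p *: rA G p + \sum_(j < k) weight j z *: rE G j.

Definition is_pole (z : R[i]) : Prop := exists j, root (rq G j) z.

(* [rev_ord p] is d - p.  The identity w_j(z) = z^d w_j(1/z) of rational
   functions is required at every point where both sides are defined, i.e. at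
   all but finitely many points. *)
Definition T_palindromic : Prop :=
  [/\ forall p, (rA G p)^T = rA G (rev_ord p),
      forall j, (rE G j)^T = rE G j
    & forall (j : 'I_k) (z : R[i]), z != 0 ->
        ~~ root (rq G j) z -> ~~ root (rq G j) z^-1 ->
        weight j z = z ^+ d * weight j z^-1].

Definition mxtuple : Type :=
  (('I_d.+1 -> 'M[R[i]]_n) * ('I_k -> 'M[R[i]]_n))%type.

Definition tuple_norm (D : mxtuple) : R :=
  Num.sqrt (\sum_p spectral_norm (D.1 p) ^+ 2
            + \sum_j spectral_norm (D.2 j) ^+ 2).

Definition backward_error (S : set mxtuple) (lam : R[i]) : \bar R :=
  ereal_inf [set (tuple_norm D)%:E | D in
    [set D : mxtuple | S D /\
       \det (\sum_(p < d.+1) lam ^+ p *: (rA G p - D.1 p)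
             + \sum_(j < k) weight j lam *: (rE G j - D.2 j)) = 0]].

Definition pal_T : set mxtuple :=
  [set D | (forall p, (D.1 p)^T = D.1 (rev_ord p))
           /\ (forall j, (D.2 j)^T = D.2 j)].

Definition backward_error_pal_T (lam : R[i]) : \bar R :=
  backward_error pal_T lam.

(* floor ((d - 1) / 2) *)
Definition half_deg : nat := d.-1./2.

Variable lam : R[i].

Definition Lambda : 'rV[R[i]]_(d.+1 + k) :=
  row_mx (\row_(p < d.+1) lam ^+ p) (\row_(j < k) weight j lam).

Definition gamma1 (j : nat) : R[i] :=
  (Num.sqrt (2 / (1 + Normc.normc lam ^+ (d - j.*2))))%:C.

Definition gamma2 (j : nat) : R[i] :=
  (Num.sqrt (2 * Normc.normc lam ^+ (d - j.*2)
             / (1 + Normc.normc lam ^+ (d - j.*2))))%:C.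

(* The last case occurs only for d even and p = d/2. *)
Definition gamma (p : 'I_d.+1) : R[i] :=
  if (p <= half_deg)%N then gamma1 p
  else if (d - p <= half_deg)%N then gamma2 (d - p)
  else 1.

Definition Gamma : 'M[R[i]]_((d.+1 + k) * n) :=
  diag_mx (row_mx (\row_p gamma p) (const_mx 1)) *t (1%:M : 'M_n).

Definition Minv : 'M[R[i]]_n := invmx (rmp_eval lam).

Definition Jmx : 'M[R[i]]_((d.+1 + k) * n) :=
  invmx Gamma *m ((adj_mx Lambda *m Lambda) *t (adj_mx Minv *m Minv))
  *m invmx Gamma.

(* Indices of the standard unit vectors start at 0 here: [evec p] is e_{p+1}. *)
Definition evec (p : 'I_d.+1) : 'cV[R[i]]_(d.+1 + k) :=
  delta_mx (lshift k p) 0.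

Definition Ctilde (p : 'I_d.+1) : 'M[R[i]]_((d.+1 + k) * n) :=
  (Lambda^T *m (evec p)^T) *t Minv^T - (evec (rev_ord p) *m Lambda) *t Minv.

Definition Smx (p : 'I_d.+1) : 'M[R[i]]_((d.+1 + k) * n) :=
  invmx Gamma *m (Ctilde p + (Ctilde p)^T) *m invmx Gamma.

(* Every [inord] below is in range: p <= half_deg <= d, and the indices of t
   are at most 2 * half_deg. *)
Definition fmx (t : 'rV[R]_(half_deg.*2.+1)) : 'M[R[i]]_((d.+1 + k) * n) :=
  \sum_(p < half_deg)
     (t 0 (inord p.*2) +i* t 0 (inord p.*2.+1)) *: Smx (inord p)
  + (t 0 (inord half_deg.*2))%:C *: Smx (inord half_deg).

Definition Fmx (t : 'rV[R]_(half_deg.*2.+1)) :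
    'M[R[i]]_((d.+1 + k) * n + (d.+1 + k) * n) :=
  block_mx Jmx (conj_mx (fmx t)) (fmx t) (conj_mx Jmx).

Definition psi (t : 'rV[R]_(half_deg.*2.+1)) : R := lambda2 (Fmx t).

End RationalMatrixPolynomial.

(* Main.v *)
Require Import Defs.
From mathcomp Require Import all_boot all_order all_algebra spectral sesquilinear.
From mathcomp Require Import boolp classical_sets reals constructive_ereal ereal.
From mathcomp Require Import topology normedtype derive.
From mathcomp Require Import complex mxtens ring lra zify.

(** Let [x] be a nonzero vector. A tuple of perturbations makes the perturbed
    value of the rational matrix polynomial singular along [x] exactly when the
    vectors [v_q] to which its matrices send [x] satisfy
    [x = M (sum_q Lambda_q v_q)]. So the matrices are traded for the
    [(d + 1 + k) x n] matrix [X] whose rows are the [v_q]; the vector [x] is then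
    recovered as the row [image_row X = Lambda X M^T]. A palindromic tuple gives
    rows with [x^T v_p = x^T v_(d-p)], because [x^T A x = x^T A^T x]; in the
    scaled variable [u = Gamma vec X] these are the equations [u^T S_p u = 0],
    while [u^H J u = |x|^2] and [|u|^2] is at most the squared tuple norm times
    [|x|^2], since the two weights of a palindromic pair have squares summing
    to 2 ([gammaR_sq_rev], [gammaR_average]).

    Lower bound. If [u^T S_p u = 0] for all [p], the form of every
    [F(t)] on the plane spanned by [(u, 0)] and [(0, conj u)] is [u^H J u / |u|^2]
    times the squared norm, so the Courant-Fischer test ([Courant_Fischer_ge])
    gives [u^H J u / |u|^2 <= lambda_2 (F t)] for every [t]
    ([feasible_lambda2]). The polynomial itself, used as a perturbation, is
    feasible, which makes the minimum positive.

    Existence of the minimum. [F] is an affine Hermitian pencil with a positive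
    semidefinite constant term. Its linear part at [t <> 0] is
    [(0, conj f; f, 0)] with [f] of rank at least 2, and therefore has a positive
    second eigenvalue ([fmx_of_rank2], [fmx_lambda2_gt0]); homogeneity and
    compactness of the sphere then make [psi] coercive, and it is Lipschitz
    ([lambda2_pencil_min]). Rank at least 2 amounts to [Lambda] not being
    proportional to a skew vector, and this is where [lambda <> 1, -1] enters.

    Equality. At a minimum which is a simple eigenvalue, no direction can
    decrease [lambda_2] to first order ([simple_lambda2_first_order]). The
    eigenspace is stable under the antilinear exchange
    [(y, z) |-> (conj z, conj y)], so it contains a vector [(u, conj u)], and
    stationarity says [u^T S_p u = 0] for all [p]. The eigenvector equation also
    shows that all rows of [X] lie in the plane spanned by [conj x] and one
    further vector [h], with coefficients such that the rows [p] and [d - p]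
    agree along [conj x] and have coefficients of equal modulus along [h]. For
    such a pair [pal_map] is a matrix of least possible norm sending [x] to the
    row [p], and whose transpose sends [x] to the row [d - p]. These matrices
    form a feasible palindromic tuple whose norm is exactly
    [1 / sqrt lambda_2]. *)

Import Order.TTheory GRing.Theory Num.Theory.
Import numFieldNormedType.Exports.
Local Open Scope ring_scope.
Local Open Scope complex_scope.

Set Implicit Arguments.
Unset Strict Implicit.
Unset Printing Implicit Defensive.

(** * Hermitian inner product on complex matrices *)

Section ComplexNumbers.
Variable R : realType.
Local Notation C := R[i].
Local Notation conj := (@Num.conj C).
Local Notation sq z := (Normc.normc z ^+ 2).

Lemma conj_real (a : R) : conj a%:C = a%:C.
Proof. exact: conjc_real. Qed.

Lemma sqC (z : C) : (sq z)%:C = conj z * z.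
Proof. by rewrite rmorphXn mulrC -normCK; case: z. Qed.

Lemma normc_conj (z : C) : Normc.normc (conj z) = Normc.normc z.
Proof. by case: z => a b /=; rewrite sqrrN. Qed.

Lemma normc_ge0 (z : C) : 0 <= Normc.normc z.
Proof. by case: z => a b; exact: sqrtr_ge0. Qed.

Lemma cReD (x y : C) : complex.Re (x + y) = complex.Re x + complex.Re y.
Proof. by case: x; case: y. Qed.

Lemma cReN (x : C) : complex.Re (- x) = - complex.Re x.
Proof. by case: x. Qed.

Lemma cRe_sum (I : Type) (r : seq I) (P : pred I) (F : I -> C) :
  complex.Re (\sum_(i <- r | P i) F i) = \sum_(i <- r | P i) complex.Re (F i).
Proof. by elim/big_rec2: _ => // i x y _ <-; rewrite cReD. Qed.

Lemma cReZ (a : R) (x : C) : complex.Re (a%:C * x) = a * complex.Re x.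
Proof. by case: x => u v /=; rewrite mul0r subr0. Qed.

Lemma cRe_conj (x : C) : complex.Re (conj x) = complex.Re x.
Proof. by case: x. Qed.

Lemma normc_real (a : R) : Normc.normc a%:C = `|a|.
Proof. by rewrite /= expr0n addr0 sqrtr_sqr. Qed.

Lemma normc_eq0 (z : C) : (Normc.normc z == 0) = (z == 0).
Proof.
by apply/eqP/eqP => [/Normc.eq0_normc //|->]; rewrite normc_real normr0.
Qed.

End ComplexNumbers.

Section InnerProduct.
Variable R : realType.
Local Notation C := R[i].
Local Notation conj := (@Num.conj C).
Local Notation sq z := (Normc.normc z ^+ 2).

Lemma adj_mxE m n (A : 'M[C]_(m, n)) i j : adj_mx A i j = conj (A j i).
Proof. by rewrite !mxE. Qed.

Lemma conj_mxK m n (A : 'M[C]_(m, n)) : conj_mx (conj_mx A) = A.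
Proof. by apply/matrixP => i j; rewrite !mxE conjCK. Qed.

Lemma conj_mx0 m n : conj_mx 0 = 0 :> 'M[C]_(m, n).
Proof. exact: map_mx0. Qed.

Lemma adj_mx0 m n : adj_mx 0 = 0 :> 'M[C]_(n, m).
Proof. by rewrite /adj_mx conj_mx0 trmx0. Qed.

Lemma conj_mxD m n (A B : 'M[C]_(m, n)) :
  conj_mx (A + B) = conj_mx A + conj_mx B.
Proof. exact: map_mxD. Qed.

Lemma conj_mxZ m n (a : C) (A : 'M[C]_(m, n)) :
  conj_mx (a *: A) = conj a *: conj_mx A.
Proof. exact: map_mxZ. Qed.

Lemma conj_mxM m n p (A : 'M[C]_(m, n)) (B : 'M[C]_(n, p)) :
  conj_mx (A *m B) = conj_mx A *m conj_mx B.
Proof. exact: map_mxM. Qed.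

Lemma conj_mx_tr m n (A : 'M[C]_(m, n)) : conj_mx A^T = (conj_mx A)^T.
Proof. by rewrite /conj_mx map_trmx. Qed.

Lemma adj_mxK m n (A : 'M[C]_(m, n)) : adj_mx (adj_mx A) = A.
Proof. by rewrite /adj_mx conj_mx_tr trmxK conj_mxK. Qed.

Lemma adj_mxM m n p (A : 'M[C]_(m, n)) (B : 'M[C]_(n, p)) :
  adj_mx (A *m B) = adj_mx B *m adj_mx A.
Proof. by rewrite /adj_mx conj_mxM trmx_mul. Qed.

Lemma adj_mxD m n (A B : 'M[C]_(m, n)) :
  adj_mx (A + B) = adj_mx A + adj_mx B.
Proof. by rewrite /adj_mx conj_mxD linearD. Qed.

Lemma adj_mxZ m n (a : C) (A : 'M[C]_(m, n)) :
  adj_mx (a *: A) = conj a *: adj_mx A.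
Proof. by rewrite /adj_mx conj_mxZ linearZ. Qed.

(** The Frobenius inner product, antilinear in the first argument; on column vectors
    it is the usual Hermitian one. *)
Definition dotc m n (X Y : 'M[C]_(m, n)) : C := \tr (adj_mx X *m Y).

Definition sqn m n (X : 'M[C]_(m, n)) : R := \sum_i \sum_j sq (X i j).

Definition qf n (H : 'M[C]_n) (y : 'cV[C]_n) : R :=
  complex.Re (dotc y (H *m y)).

Lemma dotcE m n (X Y : 'M[C]_(m, n)) :
  dotc X Y = \sum_i \sum_j conj (X i j) * Y i j.
Proof.
rewrite exchange_big; apply: eq_bigr => j _; rewrite mxE.
by apply: eq_bigr => i _; rewrite adj_mxE.
Qed.

Lemma dotcDl m n (X Y Z : 'M[C]_(m, n)) : dotc (X + Y) Z = dotc X Z + dotc Y Z.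
Proof. by rewrite /dotc adj_mxD mulmxDl raddfD. Qed.

Lemma dotcDr m n (X Y Z : 'M[C]_(m, n)) : dotc X (Y + Z) = dotc X Y + dotc X Z.
Proof. by rewrite /dotc mulmxDr raddfD. Qed.

Lemma dotcZl m n (a : C) (X Y : 'M[C]_(m, n)) :
  dotc (a *: X) Y = conj a * dotc X Y.
Proof. by rewrite /dotc adj_mxZ -scalemxAl linearZ. Qed.

Lemma dotcZr m n (a : C) (X Y : 'M[C]_(m, n)) : dotc X (a *: Y) = a * dotc X Y.
Proof. by rewrite /dotc -scalemxAr linearZ. Qed.

Lemma dotc_conj m n (X Y : 'M[C]_(m, n)) : conj (dotc X Y) = dotc Y X.
Proof.
rewrite !dotcE rmorph_sum; apply: eq_bigr => i _; rewrite rmorph_sum.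
by apply: eq_bigr => j _; rewrite rmorphM /= conjCK mulrC.
Qed.

Lemma dotc_adj m n p (A : 'M[C]_(m, n)) (X : 'M[C]_(m, p)) (Y : 'M[C]_(n, p)) :
  dotc X (A *m Y) = dotc (adj_mx A *m X) Y.
Proof. by rewrite /dotc adj_mxM adj_mxK mulmxA. Qed.

Lemma dotc_conj_mx m n (X Y : 'M[C]_(m, n)) :
  dotc (conj_mx X) (conj_mx Y) = conj (dotc X Y).
Proof.
rewrite !dotcE rmorph_sum; apply: eq_bigr => i _; rewrite rmorph_sum.
by apply: eq_bigr => j _; rewrite !mxE rmorphM.
Qed.

Lemma dotc_col_mx m1 m2 n (X X' : 'M[C]_(m1, n)) (Y Y' : 'M[C]_(m2, n)) :
  dotc (col_mx X Y) (col_mx X' Y') = dotc X X' + dotc Y Y'.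
Proof.
rewrite !dotcE big_split_ord /=; congr (_ + _); apply: eq_bigr => i _;
  by apply: eq_bigr => j _; rewrite ?col_mxEu ?col_mxEd.
Qed.

Lemma dotcc m n (X : 'M[C]_(m, n)) : dotc X X = (sqn X)%:C.
Proof.
rewrite dotcE rmorph_sum; apply: eq_bigr => i _; rewrite rmorph_sum.
by apply: eq_bigr => j _; rewrite -sqC.
Qed.

Lemma sqn_ge0 m n (X : 'M[C]_(m, n)) : 0 <= sqn X.
Proof. by do 2![apply: sumr_ge0 => ? _]; exact: sqr_ge0. Qed.

Lemma sqn_eq0 m n (X : 'M[C]_(m, n)) : (sqn X == 0) = (X == 0).
Proof.
apply/eqP/eqP => [X0|->]; last first.
  by apply: big1 => i _; apply: big1 => j _; rewrite mxE normc_real normr0 expr0n.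
apply/matrixP => i j; rewrite mxE; apply/eqP; rewrite -normc_eq0 -sqrf_eq0.
have Xi k : 0 <= \sum_j sq (X k j) by apply: sumr_ge0 => *; exact: sqr_ge0.
have /(psumr_eq0P (fun k _ => Xi k))/(_ i isT) Xi0 := X0.
by rewrite (psumr_eq0P (fun k _ => sqr_ge0 _) Xi0).
Qed.

Lemma sqn0 m n : sqn (0 : 'M[C]_(m, n)) = 0.
Proof. by apply/eqP; rewrite sqn_eq0. Qed.

Lemma sqn_gt0 m n (X : 'M[C]_(m, n)) : (0 < sqn X) = (X != 0).
Proof. by rewrite lt0r sqn_eq0 sqn_ge0 andbT. Qed.

Lemma sqnZ m n (a : C) (X : 'M[C]_(m, n)) : sqn (a *: X) = sq a * sqn X.
Proof.
by apply: complexI; rewrite rmorphM /= -!dotcc dotcZl dotcZr sqC; ring.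
Qed.

Lemma sqn_conj m n (X : 'M[C]_(m, n)) : sqn (conj_mx X) = sqn X.
Proof. by apply: complexI; rewrite -!dotcc dotc_conj_mx dotcc conj_real. Qed.

Lemma sqn_tr m n (X : 'M[C]_(m, n)) : sqn X^T = sqn X.
Proof.
by rewrite /sqn exchange_big; do 2![apply: eq_bigr => ? _]; rewrite mxE.
Qed.

Lemma sqn_col_mx m1 m2 n (X : 'M[C]_(m1, n)) (Y : 'M[C]_(m2, n)) :
  sqn (col_mx X Y) = sqn X + sqn Y.
Proof. by apply: complexI; rewrite rmorphD /= -!dotcc dotc_col_mx. Qed.

Lemma sqn_isometry m n p (U : 'M[C]_(m, n)) (X : 'M[C]_(n, p)) :
  adj_mx U *m U = 1%:M -> sqn (U *m X) = sqn X.
Proof.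
by move=> UU; apply: complexI; rewrite -!dotcc dotc_adj mulmxA UU mul1mx.
Qed.

Lemma sqnE n (y : 'cV[C]_n) : sqn y = \sum_i sq (y i 0).
Proof. by apply: eq_bigr => i _; rewrite big_ord1. Qed.

Lemma vnorm2E n (y : 'cV[C]_n) : vnorm2 y = Num.sqrt (sqn y).
Proof. by rewrite sqnE. Qed.

Lemma Cauchy_Schwarz m n (X Y : 'M[C]_(m, n)) :
  sq (dotc X Y) <= sqn X * sqn Y.
Proof.
have [->|Y0] := eqVneq Y 0.
  rewrite (_ : dotc X 0 = 0) ?normc_real ?normr0 ?expr0n ?mulr_ge0 ?sqn_ge0 //.
  by rewrite /dotc mulmx0 raddf0.
have Y_gt0 : 0 < sqn Y by rewrite sqn_gt0.
have := sqn_ge0 ((sqn Y)%:C *: X - conj (dotc X Y) *: Y).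
have -> : sqn ((sqn Y)%:C *: X - conj (dotc X Y) *: Y)
        = sqn Y * (sqn X * sqn Y - sq (dotc X Y)).
  apply: complexI; rewrite rmorphM rmorphB rmorphM /= sqC -!dotcc.
  rewrite -scaleNr !(dotcDl, dotcDr, dotcZl, dotcZr) rmorphN /= !conjCK.
  rewrite -(dotc_conj X Y) dotcc conj_real; ring.
by rewrite pmulr_rge0 // subr_ge0.
Qed.

End InnerProduct.

(** * The second largest eigenvalue of a Hermitian matrix *)

Section SecondEigenvalue.
Variable R : realType.
Local Notation C := R[i].
Local Notation conj := (@Num.conj C).
Local Notation sq z := (Normc.normc z ^+ 2).

(** For an upward closed predicate, holding at the second largest entry means holding
    at two entries at least; this replaces all reasoning about sorting. *)
Lemma nth1_sort_ge (P : pred R) (s : seq R) :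
  {homo P : x y / x <= y >-> x ==> y} -> (1 < size s)%N ->
  P (nth 0 (sort >=%R s) 1) = (1 < count P s)%N.
Proof.
move=> Pup; rewrite -(size_sort >=%R s) -(permP (permEl (perm_sort >=%R s)) P).
have: sorted >=%R (sort >=%R s) by apply: sort_sorted => x y; exact: le_total.
case: (sort _ _) => [|x [|y t]] //= /andP[yx yt] _.
have tP : ~~ P y -> count P t = 0%N.
  move=> NPy; apply/eqP; rewrite -leqn0 leqNgt -has_count; apply/hasPn => z zt.
  have /allP/(_ z zt) /= zy := order_path_min (rev_trans le_trans) yt.
  by apply: contra NPy => Pz; have /implyP-> := Pup _ _ zy.
case Py: (P y); last by rewrite (tP (negbT Py)); case: (P x).
by have /implyP-> := Pup _ _ yx.
Qed.

(** The spectral theorem, with the diagonal entries identified with the roots of the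
    characteristic polynomial, counted with multiplicity. *)
Lemma hermitian_diagonalization n (H : 'M[C]_n) : adj_mx H = H ->
  exists (P : 'M[C]_n) (a : 'I_n -> R),
    [/\ adj_mx P *m P = 1%:M, P *m adj_mx P = 1%:M,
        H = adj_mx P *m diag_mx (\row_i (a i)%:C) *m P
      & perm_eq (eigenvalues H) [seq (a i)%:C | i <- enum 'I_n]].
Proof.
move=> Hherm.
have adjE m p (A : 'M[C]_(m, p)) : map_mx conj A^T = adj_mx A.
  by rewrite /adj_mx /conj_mx map_trmx.
have H_hermsym : H \is hermsymmx.
  by apply/is_hermitianmxP; rewrite expr0 scale1r adjE Hherm.
have /orthomx_spectralP := hermitian_normalmx H_hermsym.
have := hermitian_spectral_diag_real H_hermsym.
move: (spectral_unitarymx H); set P := spectralmx H; set sp := spectral_diag H.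
move=> Punit sp_real HE.
have PP : P *m adj_mx P = 1%:M by rewrite -adjE; exact/unitarymxP.
have PP' : adj_mx P *m P = 1%:M by exact: mulmx1C.
pose a i := complex.Re (sp 0 i).
have spE : sp = \row_i (a i)%:C.
  apply/rowP => i; rewrite mxE RRe_real //.
  by move/mxOverP: sp_real; exact.
have HD : H = adj_mx P *m diag_mx (\row_i (a i)%:C) *m P.
  by rewrite HE (invmx_unitary Punit) adjE spE.
exists P, a; split => //.
rewrite /eigenvalues; case: closed_field_poly_normal => /= r.
rewrite (monicP (char_poly_monic H)) scale1r => rE.
apply: prod_XsubC_eq; rewrite -rE big_map enumT -/(index_enum _).
have -> : char_poly H = char_poly (diag_mx (\row_i (a i)%:C)).
  have PPP : map_mx polyC (adj_mx P) *m map_mx polyC P = 1%:M.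
    by rewrite -map_mxM PP' map_mx1.
  rewrite /char_poly /char_poly_mx -[RHS]mul1r -(det1 _ n) -PPP det_mulmx.
  rewrite mulrAC -!det_mulmx mulmxBr mulmxBl scalar_mxC -['X%:M *m _ *m _]mulmxA PPP mulmx1.
  by rewrite -!map_mxM -HD.
rewrite char_poly_trig; last exact: diag_mx_is_trig.
by apply: eq_bigr => i _; rewrite !mxE eqxx mulr1n.
Qed.

Lemma qf_diag n (P : 'M[C]_n) (a : 'I_n -> R) (y : 'cV[C]_n) :
  qf (adj_mx P *m diag_mx (\row_i (a i)%:C) *m P) y
  = \sum_i a i * sq ((P *m y) i 0).
Proof.
rewrite /qf -!mulmxA dotc_adj adj_mxK dotcE cRe_sum; apply: eq_bigr => i _.
rewrite big_ord1 mul_diag_mx !mxE mulrCA cReZ -sqC; congr (_ * _).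
Qed.

(** How the second eigenvalue is read off from a diagonalization. *)
Lemma lambda2_upset n (H : 'M[C]_n) (a : 'I_n -> R) (P : pred R) :
  perm_eq (eigenvalues H) [seq (a i)%:C | i <- enum 'I_n] -> (1 < n)%N ->
  {homo P : x y / x <= y >-> x ==> y} ->
  P (lambda2 H) = (1 < #|[set i | P (a i)]|)%N.
Proof.
move=> eigE n1 Pup; rewrite /lambda2.
have permE : perm_eq [seq complex.Re z | z <- eigenvalues H]
                     [seq a i | i <- enum 'I_n].
  by apply: perm_trans (perm_map _ eigE) _; rewrite -map_comp.
rewrite nth1_sort_ge //; last by rewrite (perm_size permE) size_map size_enum_ord.
by rewrite (permP permE) count_map enumT cardsE cardE /enum_mem size_filter.
Qed.

Lemma kernel_pair (u v : C) :
  exists p q : C, ((p != 0) || (q != 0)) /\ u * p + v * q = 0.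
Proof.
have [->|u0] := eqVneq u 0.
  by exists 1, 0; rewrite oner_eq0 mul0r mulr0 addr0.
by exists (- v / u), 1; rewrite oner_eq0 orbT; split => //; field.
Qed.

Lemma dotc_delta n (i : 'I_n) (y : 'cV[C]_n) : dotc (delta_mx i 0) y = y i 0.
Proof.
rewrite dotcE (bigD1 i) //= big_ord1 !mxE !eqxx rmorph1 mul1r big1 ?addr0 //.
by move=> k ki; rewrite big_ord1 mxE (negPf ki) /= rmorph0 mul0r.
Qed.

(** Half of the min-max principle: a plane spanned by two top eigenvectors meets the
    orthogonal complement of any [e]. *)
Lemma Courant_Fischer_witness n (H : 'M[C]_n) (c : R) : adj_mx H = H -> (1 < n)%N ->
  c <= lambda2 H ->
  forall e : 'cV[C]_n,
    exists y, [/\ y != 0, dotc e y = 0 & c * sqn y <= qf H y].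
Proof.
move=> Hherm n1 cH e.
have [P [a [PP PP' HE eigE]]] := hermitian_diagonalization Hherm.
have : (1 < #|[set i | (c <= a i)%R]|)%N.
  rewrite -(lambda2_upset (P := fun x => c <= x) eigE) // => x y xy.
  by apply/implyP => cx; exact: le_trans xy.
case/card_gt1P => i [j [+ + ij]]; rewrite !inE => ci cj.
(* combine two eigenvectors so as to stay orthogonal to [e] *)
have [p [q [pq0 pqe]]] := kernel_pair (conj ((P *m e) i 0)) (conj ((P *m e) j 0)).
pose z : 'cV[C]_n := p *: delta_mx i 0 + q *: delta_mx j 0.
have zE k : z k 0 = p *+ (k == i) + q *+ (k == j).
  by rewrite !mxE eqxx !andbT !mulr_natr.
have z_neq0 : z != 0.
  apply: contraTneq pq0 => z0; rewrite negb_or !negbK.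
  move: (zE i) (zE j); rewrite z0 !mxE !eqxx [j == i]eq_sym (negPf ij) addr0 add0r.
  by rewrite !mulr1n => <- <-; rewrite eqxx.
exists (adj_mx P *m z); split.
- by rewrite -sqn_eq0 sqn_isometry ?adj_mxK // sqn_eq0.
- rewrite dotc_adj adj_mxK dotcDr !dotcZr -(dotc_conj _ (P *m e)).
  rewrite -(dotc_conj _ (P *m e)) !dotc_delta -[RHS]pqe; ring.
- rewrite sqn_isometry ?adj_mxK // HE qf_diag mulmxA PP' mul1mx sqnE mulr_sumr.
  apply: ler_sum => k _; have [->|ki] := eqVneq k i.
    exact: ler_wpM2r (sqr_ge0 _) _ _ ci.
  have [->|kj] := eqVneq k j; first exact: ler_wpM2r (sqr_ge0 _) _ _ cj.
  by rewrite zE (negPf ki) (negPf kj) addr0 normc_real normr0 expr0n !mulr0.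
Qed.

(** The other half: if some direction in every hyperplane has a large form, then two
    eigenvalues are large, as is seen from the hyperplane orthogonal to the top
    eigenvector. *)
Lemma Courant_Fischer_gt n (H : 'M[C]_n) (c : R) : adj_mx H = H -> (1 < n)%N ->
  (forall e : 'cV[C]_n, exists y, dotc e y = 0 /\ c * sqn y < qf H y) ->
  c < lambda2 H.
Proof.
move=> Hherm n1 test.
have [P [a [PP PP' HE eigE]]] := hermitian_diagonalization Hherm.
rewrite (lambda2_upset (P := fun x => c < x) eigE) //; last first.
  by move=> x y xy; apply/implyP => cx; exact: lt_le_trans xy.
rewrite ltnNge; apply/negP => le1.
(* at most one eigenvalue exceeds [c]; test against its eigenvector *)
have [i0 i0P] : exists i0, forall i, i != i0 -> a i <= c.
  have [A0|[i0]] := set_0Vmem [set i | c < a i].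
    exists (Ordinal (ltnW n1)) => i _; rewrite leNgt; apply/negP => ci.
    by have := finset.in_set0 i; rewrite -A0 inE ci.
  move=> i0A; exists i0 => i; apply: contraNT; rewrite -ltNge => ci.
  by apply/eqP; apply: (card_le1_eqP le1 i0 i) => //; rewrite inE.
have [y []] := test (adj_mx P *m delta_mx i0 0).
rewrite -dotc_adj dotc_delta => Py0.
apply/negP; rewrite -leNgt HE qf_diag -(sqn_isometry y PP) sqnE mulr_sumr.
apply: ler_sum => i _; have [->|/i0P ai] := eqVneq i i0.
  by rewrite Py0 normc_real normr0 expr0n !mulr0.
exact: ler_wpM2r (sqr_ge0 _) _ _ ai.
Qed.

Lemma Courant_Fischer_ge n (H : 'M[C]_n) (c : R) : adj_mx H = H -> (1 < n)%N ->
  (forall e : 'cV[C]_n,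
     exists y, [/\ y != 0, dotc e y = 0 & c * sqn y <= qf H y]) ->
  c <= lambda2 H.
Proof.
move=> Hherm n1 test; rewrite leNgt; apply/negP => lt_c.
suff : (lambda2 H + c) / 2 < lambda2 H by lra.
apply: Courant_Fischer_gt => // e.
have [y [y0 ey yH]] := test e; exists y; split => //.
apply: lt_le_trans yH; rewrite ltr_pM2r ?sqn_gt0 //; lra.
Qed.

End SecondEigenvalue.

(** * First-order condition at a simple second eigenvalue *)

Section FirstOrder.
Variable R : realType.
Local Notation C := R[i].
Local Notation conj := (@Num.conj C).
Local Notation sq z := (Normc.normc z ^+ 2).

Lemma qfD n (A B : 'M[C]_n) y : qf (A + B) y = qf A y + qf B y.
Proof. by rewrite /qf mulmxDl dotcDr cReD. Qed.

Lemma qfZ n (a : R) (A : 'M[C]_n) y : qf (a%:C *: A) y = a * qf A y.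
Proof. by rewrite /qf -scalemxAl dotcZr cReZ. Qed.

Lemma qf_scale n (A : 'M[C]_n) (b : C) y : qf A (b *: y) = sq b * qf A y.
Proof.
by rewrite /qf -scalemxAr dotcZl dotcZr mulrA -sqC cReZ.
Qed.

Lemma qf_sum n (A : 'M[C]_n) (x y : 'cV[C]_n) : adj_mx A = A ->
  qf A (x + y) = qf A x + 2 * complex.Re (dotc x (A *m y)) + qf A y.
Proof.
move=> Aherm; rewrite /qf mulmxDr !(dotcDl, dotcDr) !cReD.
have -> : dotc y (A *m x) = conj (dotc x (A *m y)).
  by rewrite dotc_conj dotc_adj Aherm.
rewrite cRe_conj; move: (complex.Re _) (complex.Re _) (complex.Re _) => a b c.
by ring.
Qed.

Lemma qf_conjugate n (A U : 'M[C]_n) (y : 'cV[C]_n) :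
  qf (adj_mx U *m A *m U) y = qf A (U *m y).
Proof. by rewrite /qf -!mulmxA dotc_adj adj_mxK. Qed.

Lemma sqn_sub m n (x y : 'M[C]_(m, n)) :
  sqn (x - y) = sqn x - 2 * complex.Re (dotc x y) + sqn y.
Proof.
have sqnE_Re (z : 'M[C]_(m, n)) : sqn z = complex.Re (dotc z z).
  by rewrite dotcc.
rewrite !sqnE_Re -scaleN1r !(dotcDl, dotcDr, dotcZl, dotcZr) rmorphN1.
by rewrite !mulN1r opprK !(cReD, cReN) -(dotc_conj x y) cRe_conj; ring.
Qed.

(** Expansion of the nonnegative number [sqn (s x - y)]. *)
Lemma Young_dotc m n (x y : 'M[C]_(m, n)) (s : R) :
  2 * s * complex.Re (dotc x y) <= s ^+ 2 * sqn x + sqn y.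
Proof.
have := sqn_ge0 (s%:C *: x - y).
rewrite sqn_sub sqnZ dotcZl conj_real cReZ normc_real -normrX.
by rewrite ger0_norm ?sqr_ge0 //; lra.
Qed.

(** The Frobenius norm bounds the operator norm. *)
Lemma sqn_mulmx m n (A : 'M[C]_(m, n)) (y : 'cV[C]_n) :
  sqn (A *m y) <= sqn A * sqn y.
Proof.
rewrite sqnE /sqn mulr_suml; apply: ler_sum => i _.
have -> : (A *m y) i 0 = dotc (conj_mx (row i A))^T y.
  by rewrite /dotc /adj_mx conj_mx_tr trmxK conj_mxK -row_mul trace_mx11 [RHS]mxE.
apply: le_trans (Cauchy_Schwarz _ _) _.
rewrite sqn_tr sqn_conj {1}/sqn big_ord1 [leRHS]mulrC mulrC.
by rewrite -/(sqn y); under eq_bigr do rewrite mxE.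
Qed.

Lemma sqn_delta n (j : 'I_n) : sqn (delta_mx j 0 : 'cV[C]_n) = 1.
Proof. by apply: complexI; rewrite -dotcc dotc_delta mxE !eqxx. Qed.

Lemma eigenvector_of_eigenvalue n (H : 'M[C]_n) (l : R) : adj_mx H = H ->
  l%:C \in eigenvalues H -> exists2 w : 'cV[C]_n, w != 0 & H *m w = l%:C *: w.
Proof.
move=> Hherm; have [P [a [PP PP' HE eigE]]] := hermitian_diagonalization Hherm.
rewrite (perm_mem eigE) => /mapP[i _ lE].
exists (adj_mx P *m delta_mx i 0).
  by rewrite -sqn_eq0 sqn_isometry ?adj_mxK // sqn_delta oner_eq0.
rewrite HE -mulmxA [P *m _]mulmxA PP' mul1mx -mulmxA scalemxAr; congr (_ *m _).
apply/colP => j; rewrite mul_diag_mx !mxE lE andbT.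
by have [->|] := eqVneq j i; rewrite ?mulr0.
Qed.

Lemma finite_gap (I : finType) (P : pred I) (f : I -> R) :
  (forall i, P i -> 0 < f i) -> exists2 g, 0 < g & forall i, P i -> g <= f i.
Proof.
move=> f_gt0; exists (\big[Order.min/1]_(i | P i) f i).
  elim/big_ind: _ => //.
  by move=> x y x0 y0; rewrite lt_min x0.
by move=> i Pi; apply: bigmin_le_cond.
Qed.

(** Two eigenvalues above a value would make [lambda2] exceed it, so simplicity leaves
    one above and one equal. *)
Lemma simple_lambda2_split n (H : 'M[C]_n) (a : 'I_n -> R) :
  perm_eq (eigenvalues H) [seq (a i)%:C | i <- enum 'I_n] -> (1 < n)%N ->
  simple_eigenvalue H (lambda2 H)%:C ->
  exists i j, [/\ i != j, forall k, (a k == lambda2 H) = (k == j)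
    & forall k, k != i -> k != j -> a k < lambda2 H].
Proof.
move=> eigE n1; rewrite /simple_eigenvalue; set l := lambda2 H => simple.
have /eqP/cards1P[j jP] : #|[set i | a i == l]| = 1%N.
  rewrite -simple (permP eigE) count_map enumT cardsE cardE /enum_mem size_filter.
  by apply: eq_count => i /=; rewrite (inj_eq (@complexI _)).
have aj k : (a k == l) = (k == j).
  by move/setP/(_ k): jP; rewrite !inE.
have ge2 : (1 < #|[set i | (l <= a i)%R]|)%N.
  rewrite -(lambda2_upset (P := fun x => l <= x) eigE) // => x y xy.
  by apply/implyP => cx; exact: le_trans xy.
have gt1 : (#|[set i | (l < a i)%R]| <= 1)%N.
  rewrite leqNgt -(lambda2_upset (P := fun x => l < x) eigE) ?ltxx // => x y xy.
  by apply/implyP => cx; exact: lt_le_trans xy.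
have [i [ij li]] : exists i, i != j /\ l < a i.
  case/card_gt1P: ge2 => x [y [+ + xy]]; rewrite !inE => lx ly.
  have [xj|xj] := eqVneq x j; last by exists x; rewrite xj lt_neqAle lx andbT eq_sym aj.
  have yj : y != j by rewrite -xj eq_sym.
  by exists y; rewrite yj lt_neqAle ly andbT eq_sym aj.
exists i, j; split => //.
move=> k ki kj; rewrite lt_neqAle aj kj leNgt; apply/negP => lk.
by case/eqP: ki; apply: (card_le1_eqP gt1 i k); rewrite inE.
Qed.

(** The form [H] on [z = zj e_j + r], where [- (2 s)] is its value on [e_j], [b] and
    [rho] are the squared norms of the two parts, [X] is their cross term and [Q] the
    form on [r]. Half of the negative term absorbs the cross term. *)
Fact cross_term_bound (s b K rho X Q hr : R) :
  0 < s -> 0 <= K -> 0 <= rho -> 2 * s * X <= s ^+ 2 * b + hr ->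
  2 * 1 * Q <= 1 ^+ 2 * rho + hr -> hr <= K * rho ->
  b * (- (2 * s)) + 2 * X + Q <= - (s * b) + (K / s + 1 + K) * rho.
Proof.
move=> s_gt0 K_ge0 rho_ge0 cross self hrK.
have Krho : 0 <= K * rho by rewrite mulr_ge0.
have : 2 * X <= s * b + K / s * rho.
  rewrite -(ler_pM2l s_gt0).
  have -> : s * (s * b + K / s * rho) = s ^+ 2 * b + K * rho.
    by field; rewrite gt_eqF.
  lra.
rewrite !mulrDl; lra.
Qed.

(** With step [g / (2 K2)] the spectral gap [g] dominates what the perturbation gains
    on the complement, so the perturbed form falls below [l] everywhere. *)
Fact small_step_contradiction (s b rho g K2 l Fz Hz : R) :
  0 < s -> 0 <= b -> 0 <= rho -> 0 < b + rho -> 0 < g -> 0 < K2 ->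
  l * (b + rho) <= Fz + g / (2 * K2) * Hz -> Fz <= l * b + (l - g) * rho ->
  Hz <= - (s * b) + K2 * rho -> False.
Proof.
move=> s_gt0 b_ge0 rho_ge0 brho g_gt0 K2_gt0.
have eps_gt0 : 0 < g / (2 * K2) by rewrite divr_gt0 // mulr_gt0.
have epsE : g / (2 * K2) * K2 = g / 2 by field; rewrite gt_eqF.
move: (g / (2 * K2)) eps_gt0 epsE => eps eps_gt0 epsE ineq Fle Hle.
have := ler_wpM2l (ltW eps_gt0) Hle; rewrite mulrDr mulrA epsE => epsH.
have bad : g / 2 * rho + eps * s * b <= 0 by lra.
have [rho0|rho_neq0] := eqVneq rho 0.
  rewrite rho0 addr0 in brho; have : 0 < eps * s * b by rewrite !mulr_gt0.
  rewrite rho0 in bad; lra.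
have : 0 < g / 2 * rho by rewrite !mulr_gt0 // lt0r rho_neq0.
have : 0 <= eps * s * b by rewrite !mulr_ge0 // ltW.
lra.
Qed.

(** If the form of [H] at the eigenvector were negative, a small step along [H] would
    push the form strictly below [lambda2 F] on the whole hyperplane orthogonal to the
    top eigenvector, because the remaining eigenvalues stay below by a gap. By
    Courant-Fischer the second eigenvalue would decrease. *)
Lemma simple_lambda2_first_order n (F H : 'M[C]_n) (w : 'cV[C]_n) :
  adj_mx F = F -> adj_mx H = H -> (1 < n)%N ->
  simple_eigenvalue F (lambda2 F)%:C -> F *m w = (lambda2 F)%:C *: w ->
  (forall eps : R, 0 < eps -> lambda2 F <= lambda2 (F + eps%:C *: H)) ->
  0 <= qf H w.
Proof.
move=> Fherm Hherm n1 simple Fw minF.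
have [P [a [PP PP' FE eigE]]] := hermitian_diagonalization Fherm.
have [i [j [ij aE gap]]] := simple_lambda2_split eigE n1 simple.
move: simple Fw minF aE gap; set l := lambda2 F => simple Fw minF aE gap.
have aj : a j = l by apply/eqP; rewrite aE.
have [g g_gt0 gP] : exists2 g, 0 < g &
    forall k, (k != i) && (k != j) -> g <= l - a k.
  by apply: finite_gap => k /andP[ki kj]; rewrite subr_gt0 gap.
(* in an eigenbasis of [F], [w] is a multiple of the [j]-th basis vector *)
pose H' := P *m H *m adj_mx P.
have H'herm : adj_mx H' = H' by rewrite /H' !adj_mxM adj_mxK Hherm mulmxA.
have qfH y : qf H y = qf H' (P *m y).
  rewrite -qf_conjugate /H' !mulmxA PP mul1mx -mulmxA PP mulmx1 //.
have PwE : P *m w = (P *m w) j 0 *: delta_mx j 0.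
  apply/colP => k; rewrite [RHS]mxE [delta_mx _ _ _ _]mxE eqxx andbT mulr_natr.
  have [->|kj] := eqVneq k j; first by rewrite mulr1n.
  have : (a k)%:C * (P *m w) k 0 = l%:C * (P *m w) k 0.
    have /(congr1 (fun v => (P *m v) k 0)) := Fw.
    rewrite FE !mulmxA PP' mul1mx -mulmxA mul_diag_mx -scalemxAr.
    by rewrite [in X in X -> _]mxE [in X in _ = X -> _]mxE [(\row__ _) _ _]mxE.
  move/eqP; rewrite -subr_eq0 -mulrBl mulf_eq0 subr_eq0 (inj_eq (@complexI _)).
  by rewrite aE (negPf kj) => /eqP.
rewrite qfH PwE qf_scale mulr_ge0 ?sqr_ge0 // leNgt; apply/negP.
move=> d_lt0.
pose s := - qf H' (delta_mx j 0) / 2.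
have sE : qf H' (delta_mx j 0) = - (2 * s) by rewrite /s; field.
have s_gt0 : 0 < s by rewrite /s divr_gt0 // oppr_gt0.
have K_ge0 := sqn_ge0 H'; set K := sqn H' in K_ge0.
pose K2 := K / s + 1 + K.
have K2_gt0 : 0 < K2.
  by rewrite ltr_wpDr // ltr_wpDl // divr_ge0 // ltW.
have eps_gt0 : 0 < g / (2 * K2) by rewrite divr_gt0 // mulr_gt0.
set eps := g / (2 * K2) in eps_gt0.
have FHherm : adj_mx (F + eps%:C *: H) = F + eps%:C *: H.
  by rewrite adj_mxD adj_mxZ conj_real Fherm Hherm.
(* orthogonality to the top eigenvector leaves only [j] and the gap *)
have [y [y0 ey]] :=
  Courant_Fischer_witness FHherm n1 (minF _ eps_gt0) (adj_mx P *m delta_mx i 0).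
rewrite -dotc_adj dotc_delta in ey *.
rewrite qfD qfZ qfH FE qf_diag -(sqn_isometry y PP).
have z0 : P *m y != 0 by rewrite -sqn_eq0 sqn_isometry // sqn_eq0.
move: (P *m y) z0 ey => z z0 zi.
pose r : 'cV[C]_n := \col_k (if k == j then 0 else z k 0).
have zE : z = z j 0 *: delta_mx j 0 + r.
  apply/colP => k; rewrite !mxE eqxx andbT.
  by have [->|] := eqVneq k j; rewrite ?mulr1 ?mulr0 ?addr0 ?add0r.
set b := sq (z j 0).
have b0 : 0 <= b by exact: sqr_ge0.
have r0 := sqn_ge0 r.
have zsum (f : 'I_n -> R) : \sum_k f k * sq (z k 0) = f j * b + \sum_k f k * sq (r k 0).
  rewrite (bigD1 j) //= [in RHS](bigD1 j) //= mxE eqxx normc_real normr0 expr0n mulr0 add0r.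
  by congr (_ + _); apply: eq_bigr => k /negPf kj; rewrite mxE kj.
have zn : sqn z = b + sqn r.
  rewrite !sqnE; have := zsum (fun=> 1); rewrite mul1r.
  by under eq_bigr do rewrite mul1r; under [in X in _ = _ + X -> _]eq_bigr do rewrite mul1r.
have Fle : \sum_k a k * sq (z k 0) <= l * b + (l - g) * sqn r.
  rewrite zsum aj lerD2l sqnE mulr_sumr; apply: ler_sum => k _.
  have [kij|] := boolP ((k != i) && (k != j)).
    by apply: ler_wpM2r (sqr_ge0 _) _ _ _; have := gP k kij; rewrite lerBrDr addrC -lerBrDr.
  rewrite negb_and !negbK mxE.
  have [_|_] := eqVneq k j; first by rewrite normc_real normr0 expr0n !mulr0.
  by rewrite orbF => /eqP->; rewrite zi normc_real normr0 expr0n !mulr0.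
have Hle : qf H' z <= - (s * b) + K2 * sqn r.
  rewrite {1}zE qf_sum // qf_scale sE -/b.
  have cross := Young_dotc (z j 0 *: delta_mx j 0) (H' *m r) s.
  rewrite sqnZ sqn_delta mulr1 in cross.
  exact: cross_term_bound s_gt0 K_ge0 r0 cross (Young_dotc r _ 1) (sqn_mulmx _ _).
move=> ineq; apply: small_step_contradiction s_gt0 b0 r0 _ g_gt0 K2_gt0 _ Fle Hle.
  by rewrite -zn sqn_gt0.
by rewrite -zn.
Qed.

End FirstOrder.

(** * Spectral norm and least-norm palindromic mappings *)

Section SpectralNorm.
Variable R : realType.
Local Notation C := R[i].
Local Notation conj := (@Num.conj C).
Local Notation sq z := (Normc.normc z ^+ 2).

Lemma vnorm2_le n (x : 'cV[C]_n) (r : R) : 0 <= r ->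
  (vnorm2 x <= r) = (sqn x <= r ^+ 2).
Proof.
move=> r0; rewrite vnorm2E -{1}(ger0_norm r0) -sqrtr_sqr ler_sqrt //.
exact: sqr_ge0.
Qed.

Lemma spectral_norm_has_sup n (A : 'M[C]_n) :
  has_sup [set vnorm2 (A *m x) | x in [set x : 'cV[C]_n | vnorm2 x <= 1]]%classic.
Proof.
split; first by exists (vnorm2 (A *m 0)); exists 0 => //=; rewrite vnorm2_le // expr1n sqn0.
exists (Num.sqrt (sqn A)) => _ [x /= x1 <-]; rewrite vnorm2_le ?sqrtr_ge0 //.
rewrite sqr_sqrtr ?sqn_ge0 //; apply: le_trans (sqn_mulmx _ _) _.
by rewrite ler_piMr ?sqn_ge0 //; rewrite vnorm2_le ?expr1n in x1.
Qed.

Lemma spectral_norm_ge0 n (A : 'M[C]_n) : 0 <= spectral_norm A.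
Proof.
apply: le_trans (sqrtr_ge0 _) (ub_le_sup (spectral_norm_has_sup A).2 _).
by exists 0; rewrite /= ?vnorm2E // -vnorm2E vnorm2_le // expr1n sqn0.
Qed.

Lemma sqn_mulmx_spectral_norm n (A : 'M[C]_n) (x : 'cV[C]_n) :
  sqn (A *m x) <= spectral_norm A ^+ 2 * sqn x.
Proof.
have [->|x0] := eqVneq x 0; first by rewrite mulmx0 sqn0 mulr0.
have x_gt0 : 0 < sqn x by rewrite sqn_gt0.
pose s := (Num.sqrt (sqn x))^-1.
have s2 : s ^+ 2 = (sqn x)^-1 by rewrite exprVn sqr_sqrtr ?ltW.
have sqs : sq (s%:C : C) = (sqn x)^-1.
  by rewrite normc_real -normrX ger0_norm ?s2 ?invr_ge0 ?ltW.
rewrite -ler_pdivrMr // mulrC -sqs -sqnZ -vnorm2_le ?spectral_norm_ge0 //.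
apply: ub_le_sup (spectral_norm_has_sup A).2 _ _.
exists (s%:C *: x); last by rewrite scalemxAr.
by rewrite /= vnorm2_le // sqnZ sqs mulVf ?gt_eqF // expr1n.
Qed.

Lemma spectral_norm_le n (A : 'M[C]_n) (r : R) : 0 <= r ->
  (forall x : 'cV[C]_n, sqn (A *m x) <= r ^+ 2 * sqn x) -> spectral_norm A <= r.
Proof.
move=> r0 Ar; apply: ge_sup (spectral_norm_has_sup A).1 _ => _ [x /= x1 <-].
rewrite vnorm2_le //; apply: le_trans (Ar x) _.
by rewrite ler_piMr ?sqr_ge0 //; rewrite vnorm2_le ?expr1n in x1.
Qed.

(** Cauchy-Schwarz applied to [|A^T x|^2], whose adjoint is the conjugate of [A]. *)
Lemma spectral_norm_tr_le n (A : 'M[C]_n) : spectral_norm A^T <= spectral_norm A.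
Proof.
apply: spectral_norm_le => [|x]; first exact: spectral_norm_ge0.
have [->|y0] := eqVneq (A^T *m x) 0.
  by rewrite sqn0 mulr_ge0 ?sqr_ge0 ?sqn_ge0.
have y_gt0 : 0 < sqn (A^T *m x) by rewrite sqn_gt0.
rewrite -(ler_pM2l y_gt0).
have -> : sqn (A^T *m x) * sqn (A^T *m x) = sq (dotc (adj_mx A^T *m (A^T *m x)) x).
  by rewrite -dotc_adj dotcc normc_real real_normK ?num_real ?expr2.
apply: le_trans (Cauchy_Schwarz _ _) _.
rewrite mulrCA mulrA ler_wpM2r ?sqn_ge0 //.
have -> : adj_mx A^T = conj_mx A by rewrite /adj_mx conj_mx_tr trmxK.
rewrite -sqn_conj conj_mxM conj_mxK -[X in _ <= _ * X]sqn_conj.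
exact: sqn_mulmx_spectral_norm.
Qed.

Lemma spectral_norm_tr n (A : 'M[C]_n) : spectral_norm A^T = spectral_norm A.
Proof.
apply/le_anti/andP; split; first exact: spectral_norm_tr_le.
by rewrite -{1}[A]trmxK; exact: spectral_norm_tr_le.
Qed.

End SpectralNorm.

(** The squared norm of [pal_map] at a vector with coordinates [al], [be]. Primed letters
    stand for complex conjugates and [c] for the third coefficient; the cross terms
    cancel because [b' b = c' c]. *)
Fact pal_map_norm_identity (K : fieldType) (a a' al al' be be' b b' c c' X Y : K) :
  X != 0 -> Y != 0 -> b != 0 -> b' != 0 -> c != 0 -> c' != 0 -> b' * b = c' * c ->
  (X^-1 * (a' * al' + c' * be')) * (X^-1 * (a * al + c * be)) * X
  + (X^-1 * (b' * al') - a * c' / (b * Y) * be')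
    * (X^-1 * (b * al) - a' * c / (b' * Y) * be) * Y
  = (a' * a * X + b' * b * Y) / X * (al' * al / X + be' * be / Y).
Proof.
move=> X0 Y0 b0 b'0 c0 c'0 bc; have -> : b' = c' * c / b by rewrite -bc; field.
by field; rewrite X0 Y0 b0 c0 c'0.
Qed.

Fact pal_map_mul_identity (K : comRingType) m (u v : 'cV[K]_m) (y z a b b' al be : K) :
  y *: (a *: (al *: u) + b *: (al *: v) + b' *: (be *: u)) - z *: (be *: v)
  = (y * (a * al + b' * be)) *: u + (y * (b * al) - z * be) *: v.
Proof. by apply/colP => i; rewrite !mxE; ring. Qed.

Section PalindromicMapping.
Variable R : realType.
Local Notation C := R[i].
Local Notation conj := (@Num.conj C).
Local Notation sq z := (Normc.normc z ^+ 2).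

Variables (n : nat) (x h : 'cV[C]_n).
Local Notation X := (sqn x)%:C.
Local Notation Y := (sqn h)%:C.

(** A matrix supported on the plane spanned by [x] and [conj h], with values in the
    plane spanned by [conj x] and [h]. In normalized bases it is
    [((a, b'), (b, c))]; the corner [c] makes the columns orthogonal, so that for
    [|b| = |b'|] the matrix is a multiple of a unitary one. For [h = 0] the corner is 0
    since [0^-1 = 0]. *)
Definition pal_map (a b b' : C) : 'M[C]_n :=
  X^-1 *: (a *: (conj_mx x *m adj_mx x) + b *: (h *m adj_mx x)
           + b' *: (conj_mx x *m h^T))
  - (conj a * b' / (conj b * Y)) *: (h *m h^T).

(** Equal moduli make the corner symmetric in [b] and [b'], so transposition only
    exchanges them. In particular [pal_map a b b] is symmetric. *)
Lemma pal_map_tr a b b' : b != 0 -> Normc.normc b = Normc.normc b' ->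
  (pal_map a b b')^T = pal_map a b' b.
Proof.
move=> b0 bb'.
have b'0 : b' != 0 by rewrite -normc_eq0 -bb' normc_eq0.
have bbC : conj b * b = conj b' * b' by rewrite -!sqC bb'.
rewrite /pal_map.
have trD (A B : 'M[C]_n) : (A + B)^T = A^T + B^T by exact: linearD.
have trZ c (A : 'M[C]_n) : (c *: A)^T = c *: A^T by exact: linearZ.
have trN (A : 'M[C]_n) : (- A)^T = - A^T by exact: linearN.
rewrite !(trD, trN, trZ) !trmx_mul /adj_mx !trmxK.
have -> : conj a * b' / (conj b * Y) = conj a * b / (conj b' * Y).
  rewrite -!mulrA; congr (_ * _); rewrite !invfM !mulrA; congr (_ * _).
  by apply/eqP; rewrite eqr_div ?conjC_eq0 // ![_ * conj _]mulrC -bbC.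
by rewrite -![in LHS]addrA [X in _ *: (_ + X)]addrC !addrA.
Qed.

Hypothesis x_neq0 : x != 0.
Hypothesis xh0 : h^T *m x = 0.

Let X_neq0 : X != 0.
Proof. by rewrite -(rmorph0 (real_complex R)) (inj_eq (@complexI _)) sqn_eq0. Qed.

Lemma outer_adj_mul (u v w : 'cV[C]_n) : u *m adj_mx v *m w = dotc v w *: u.
Proof. by rewrite -mulmxA [_ *m w]mx11_scalar -trace_mx11 mul_mx_scalar. Qed.

Lemma outer_tr_mul (u v w : 'cV[C]_n) :
  u *m v^T *m w = dotc (conj_mx v) w *: u.
Proof. by rewrite -outer_adj_mul /adj_mx conj_mxK. Qed.

Let hx : dotc (conj_mx h) x = 0.
Proof.
by rewrite /dotc /adj_mx conj_mxK xh0 mxtrace0.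
Qed.

Lemma pal_map_mul a b b' (w : 'cV[C]_n) :
  let al := dotc x w in let be := dotc (conj_mx h) w in
  pal_map a b b' *m w
  = (X^-1 * (a * al + b' * be)) *: conj_mx x
    + (X^-1 * (b * al) - conj a * b' / (conj b * Y) * be) *: h.
Proof.
move=> al be; rewrite /pal_map mulmxBl -!scalemxAl !mulmxDl -!scalemxAl.
by rewrite !outer_adj_mul !outer_tr_mul -/al -/be pal_map_mul_identity.
Qed.

Lemma pal_map_apply a b b' : pal_map a b b' *m x = a *: conj_mx x + b *: h.
Proof.
rewrite pal_map_mul hx dotcc !mulr0 subr0 addr0.
by congr (_ *: _ + _ *: _); field.
Qed.

(** Bessel's inequality for the orthogonal pair [x], [conj h]. *)
Lemma Bessel_pair (w : 'cV[C]_n) :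
  sq (dotc x w) / sqn x + sq (dotc (conj_mx h) w) / sqn h <= sqn w.
Proof.
have x_gt0 : 0 < sqn x by rewrite sqn_gt0.
have [h0|h_neq0] := eqVneq h 0.
  rewrite {2}h0 sqn0 invr0 mulr0 addr0 ler_pdivrMr // mulrC.
  exact: Cauchy_Schwarz.
have Y_neq0 : Y != 0.
  by rewrite -(rmorph0 (real_complex R)) (inj_eq (@complexI _)) sqn_eq0.
set al := dotc x w; set be := dotc (conj_mx h) w.
rewrite -subr_ge0.
have -> : sqn w - (sq al / sqn x + sq be / sqn h)
    = sqn (w + (- (al / X)) *: x + (- (be / Y)) *: conj_mx h).
  apply: complexI; rewrite rmorphB rmorphD /=.
  rewrite [(sq al / _)%:C]rmorphM [(sq be / _)%:C]rmorphM /= !fmorphV !sqC.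
  rewrite -[RHS]dotcc !(dotcDl, dotcDr, dotcZl, dotcZr) !dotcc sqn_conj -/al -/be.
  rewrite hx -(dotc_conj (conj_mx h) x) hx rmorph0.
  rewrite -(dotc_conj x w) -(dotc_conj (conj_mx h) w) -/al -/be.
  rewrite !rmorphN !rmorphM !fmorphV /= !conj_real.
  move: (conj al) (conj be) X_neq0 Y_neq0; clearbody al be; move: X Y => s t.
  by move=> al' be' s0 t0; field; rewrite s0 t0.
exact: sqn_ge0.
Qed.

Lemma sqn_conj_orthogonal p q :
  sqn (p *: conj_mx x + q *: h) = sq p * sqn x + sq q * sqn h.
Proof.
apply: complexI; rewrite rmorphD /= [(sq p * _)%:C]rmorphM [(sq q * _)%:C]rmorphM.
rewrite /= !sqC -!dotcc !(dotcDl, dotcDr, dotcZl, dotcZr).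
have xh : dotc (conj_mx x) h = 0.
  by rewrite -[h]conj_mxK dotc_conj_mx -dotc_conj hx !rmorph0.
by rewrite -(dotc_conj (conj_mx x) h) xh rmorph0 !mulr0 addr0 add0r !mulrA !dotcc sqn_conj.
Qed.

(** The bound is the norm of the image of [x] divided by that of [x], hence is the
    least possible. *)
Lemma pal_map_spectral_norm a b b' : b != 0 -> Normc.normc b = Normc.normc b' ->
  spectral_norm (pal_map a b b')
  <= Num.sqrt (sqn (a *: conj_mx x + b *: h) / sqn x).
Proof.
move=> b_neq0 bb'; have x_gt0 : 0 < sqn x by rewrite sqn_gt0.
have orth := sqn_conj_orthogonal.
apply: spectral_norm_le => [|w]; first exact: sqrtr_ge0.
rewrite sqr_sqrtr ?divr_ge0 ?sqn_ge0 // pal_map_mul !orth.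
set al := dotc x w; set be := dotc (conj_mx h) w.
have -> : sq (X^-1 * (a * al + b' * be)) * sqn x
    + sq (X^-1 * (b * al) - conj a * b' / (conj b * Y) * be) * sqn h
  = (sq a * sqn x + sq b * sqn h) / sqn x
    * (sq al / sqn x + sq be / sqn h).
  have [h0|h_neq0] := eqVneq h 0.
    have be0 : be = 0.
      by rewrite /be h0 conj_mx0 /dotc adj_mx0 mul0mx mxtrace0.
    rewrite h0 sqn0 be0 !mulr0 addr0 invr0 addr0 mulr0 addr0.
    rewrite !Normc.normcM Normc.normcV normc_real ger0_norm ?sqn_ge0 //.
    by field; rewrite gt_eqF.
  have Y_neq0 : Y != 0.
    by rewrite -(rmorph0 (real_complex R)) (inj_eq (@complexI _)) sqn_eq0.
  have b'_neq0 : b' != 0 by rewrite -normc_eq0 -bb' normc_eq0.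
  have bbC : conj b * b = conj b' * b' by rewrite -!sqC bb'.
  have sqMC p (s : R) : (sq p * s)%:C = conj p * p * s%:C :> C.
    by rewrite [(_ * _)%:C]rmorphM /= sqC.
  apply: complexI.
  transitivity ((sq a * sqn x + sq b * sqn h)%:C / X
                * (sq al / sqn x + sq be / sqn h)%:C); last first.
    by rewrite [in RHS]rmorphM /= [in RHS]rmorphM /= fmorphV.
  rewrite !rmorphD /= !sqMC !fmorphV /=.
  have cb0 : conj b != 0 by rewrite conjC_eq0.
  have cb'0 : conj b' != 0 by rewrite conjC_eq0.
  rewrite -(pal_map_norm_identity a (conj a) al (conj al) be (conj be)
              X_neq0 Y_neq0 b_neq0 cb0 b'_neq0 cb'0 bbC).
  congr (_ * _ * _ + _ * _ * _);
    rewrite ?(rmorphM, rmorphB, rmorphD, fmorphV) /= ?conj_real //.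
  by rewrite !conjCK.
by rewrite ler_wpM2l ?Bessel_pair // divr_ge0 ?sqn_ge0 // -orth sqn_ge0.
Qed.

End PalindromicMapping.

(** * Minimizing the second eigenvalue over a Hermitian pencil *)

Section HermitianPencil.
Variable R : realType.
Local Notation C := R[i].

(** Monotonicity and 1-Lipschitz continuity of the second eigenvalue in one statement. *)
Lemma lambda2_perturbation n (H H' : 'M[C]_n) (dlt : R) :
  adj_mx H = H -> adj_mx H' = H' -> (1 < n)%N ->
  (forall y : 'cV[C]_n, qf H y <= qf H' y + dlt * sqn y) ->
  lambda2 H <= lambda2 H' + dlt.
Proof.
move=> Hherm H'herm n1 HH'; rewrite -lerBlDr; apply: Courant_Fischer_ge => // e.
have [y [y0 ey yH]] := Courant_Fischer_witness Hherm n1 (lexx _) e.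
by exists y; split => //; rewrite mulrBl lerBlDr (le_trans yH).
Qed.

Lemma lambda2_pos_scale n (H : 'M[C]_n) (s : R) : adj_mx H = H -> (1 < n)%N ->
  0 < s -> s * lambda2 H <= lambda2 (s%:C *: H).
Proof.
move=> Hherm n1 s_gt0; apply: Courant_Fischer_ge => // [|e].
  by rewrite adj_mxZ conj_real Hherm.
have [y [y0 ey yH]] := Courant_Fischer_witness Hherm n1 (lexx _) e.
by exists y; split => //; rewrite qfZ -mulrA ler_pM2l.
Qed.

Lemma lambda2_ge0 n (H : 'M[C]_n) : adj_mx H = H -> (1 < n)%N ->
  (forall y : 'cV[C]_n, 0 <= qf H y) -> 0 <= lambda2 H.
Proof.
move=> Hherm n1 H0; apply: Courant_Fischer_ge => // e.
have [y [y0 ey _]] := Courant_Fischer_witness Hherm n1 (lexx _) e.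
by exists y; rewrite mul0r.
Qed.

Lemma qf_le_sqn n (B : 'M[C]_n) (y : 'cV[C]_n) :
  `|qf B y| <= (1 + sqn B) * sqn y.
Proof.
have B0 : 0 <= sqn B * sqn y by rewrite mulr_ge0 ?sqn_ge0.
have := Young_dotc y (B *m y) 1; have := Young_dotc y (B *m y) (-1).
have := sqn_mulmx B y; have := sqn_ge0 y.
by rewrite -/(qf B y) ler_norml; move: (qf B y) => q; lra.
Qed.

Variables (n s : nat) (F0 : 'M[C]_n) (B : 'I_s.+1 -> 'M[C]_n).
Hypotheses (n_gt1 : (1 < n)%N) (F0_herm : adj_mx F0 = F0).
Hypothesis B_herm : forall i, adj_mx (B i) = B i.

Definition pencil (t : 'rV[R]_s.+1) : 'M[C]_n := \sum_i (t 0 i)%:C *: B i.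

Lemma pencil_herm t : adj_mx (pencil t) = pencil t.
Proof.
rewrite /pencil /adj_mx /conj_mx [map_mx _ _]raddf_sum raddf_sum.
apply: eq_bigr => i _; rewrite -[RHS]/(_ *: _) -{2}(B_herm i).
by rewrite -(conj_real (t 0 i)) -adj_mxZ conj_real.
Qed.

Lemma pencilZ (c : R) t : pencil (c *: t) = c%:C *: pencil t.
Proof.
rewrite /pencil scaler_sumr; apply: eq_bigr => i _.
by rewrite mxE rmorphM scalerA.
Qed.

Lemma qf_pencil t y : qf (pencil t) y = \sum_i t 0 i * qf (B i) y.
Proof.
rewrite /pencil; elim/big_rec2: _ => [|i u v _ <-]; last by rewrite qfD qfZ.
by rewrite /qf mul0mx /dotc mulmx0 mxtrace0.
Qed.

Let K := \sum_i (1 + sqn (B i)).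

Lemma coord_le_norm (t : 'rV[R]_s.+1) i : `|t 0 i| <= `|t|.
Proof.
rewrite [leRHS]/Num.norm /= mx_normrE; apply/bigmax_geP; right => /=.
by exists (0, i).
Qed.

Lemma lambda2_pencil_Lipschitz (E : 'M[C]_n) t t' : adj_mx E = E ->
  `|lambda2 (E + pencil t) - lambda2 (E + pencil t')| <= K * `|t - t'|.
Proof.
move=> Eherm; have le u u' :
    lambda2 (E + pencil u) <= lambda2 (E + pencil u') + K * `|u - u'|.
  apply: lambda2_perturbation => // [||y]; rewrite ?adj_mxD ?Eherm ?pencil_herm //.
  rewrite !qfD -addrA lerD2l !qf_pencil -lerBlDl -sumrB /K !mulr_suml.
  apply: ler_sum => i _; rewrite -mulrBl; apply: le_trans (ler_norm _) _.
  rewrite normrM mulrAC mulrC ler_pM ?normr_ge0 ?qf_le_sqn //.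
  by have := coord_le_norm (u - u') i; rewrite !mxE.
have := le t t'; have := le t' t; rewrite distrC ler_norml.
move: (lambda2 _) (lambda2 _) (K * _) => u u' v; lra.
Qed.

Lemma lambda2_pencil_continuous (E : 'M[C]_n) : adj_mx E = E ->
  continuous (fun t => lambda2 (E + pencil t)).
Proof.
move=> Eherm t.
apply/(@cvgrPdist_le _ _ _ _ (nbhs_filter (t : 'rV[R]_s.+1))) => e e_gt0.
have K_gt0 : 0 < K + 1.
  by rewrite ltr_wpDl // sumr_ge0 // => i _; rewrite addr_ge0 ?sqn_ge0.
apply/(nbhs_normP (V := 'rV[R]_s.+1) t).
exists (e / (K + 1)); rewrite /= ?divr_gt0 // => t' /=.
rewrite ltr_pdivlMr // => /ltW; apply: le_trans.
apply: le_trans (lambda2_pencil_Lipschitz _ _ Eherm) _.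
by rewrite mulrC ler_wpM2l ?lerDl.
Qed.

Lemma closed_norm_preimage (D : set R) : closed D ->
  closed [set t : 'rV[R]_s.+1 | D `|t|]%classic.
Proof.
move=> Dclosed; apply: (@preimage_closed 'rV[R]_s.+1 R (fun t => `|t|)) => //.
by move=> t _; exact: norm_continuous.
Qed.

Hypothesis F0_psd : forall y, 0 <= qf F0 y.
Hypothesis pencil_pos : forall t, t != 0 -> 0 < lambda2 (pencil t).

(** By homogeneity it suffices to bound the second eigenvalue below on the unit
    sphere, where it attains a positive minimum. *)
Lemma lambda2_pencil_coercive :
  exists2 c, 0 < c & forall t, c * `|t| <= lambda2 (pencil t).
Proof.
have zero_herm : adj_mx (0 : 'M[C]_n) = 0 by exact: adj_mx0.
have cont := lambda2_pencil_continuous zero_herm.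
pose S := [set t : 'rV[R]_s.+1 | `|t| = 1]%classic.
have [| | |t0 t0S t0P] := @EVT_min_rV R _ (fun t => lambda2 (0 + pencil t)) S.
- have one_neq0 : const_mx 1 != 0 :> 'rV[R]_s.+1.
    by apply/eqP => /rowP/(_ 0)/eqP; rewrite !mxE oner_eq0.
  exists (`|const_mx 1 : 'rV[R]_s.+1|^-1 *: const_mx 1); rewrite /S /=.
  by rewrite normrZ normfV normr_id mulVf // normr_eq0.
- apply: bounded_closed_compact.
    exists 1; split => // x x1 t; rewrite /S /= => ->; exact: ltW.
  exact: (closed_norm_preimage (@closed_eq _ (1 : R))).
- exact: continuous_subspaceT.
have t0_neq0 : t0 != 0.
  apply: contraTneq t0S => ->; rewrite notin_setE /S /= normr0.
  by move=> /esym/eqP; rewrite oner_eq0.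
exists (lambda2 (pencil t0)); first exact: pencil_pos.
move=> t; have [->|t_neq0] := eqVneq t 0.
  rewrite normr0 mulr0; apply: lambda2_ge0 => // [|y]; first exact: pencil_herm.
  by rewrite qf_pencil big1 // => i _; rewrite mxE mul0r.
have t_gt0 : 0 < `|t| by rewrite normr_gt0.
have tE : t = `|t| *: (`|t|^-1 *: t) by rewrite scalerA divff ?scale1r ?gt_eqF.
rewrite [in leRHS]tE pencilZ mulrC.
apply: le_trans (lambda2_pos_scale (pencil_herm _) n_gt1 t_gt0).
rewrite ler_pM2l //; have := t0P (`|t|^-1 *: t); rewrite !add0r; apply.
rewrite inE /S /= normrZ ger0_norm ?invr_ge0 // mulVf ?gt_eqF //.
Qed.

(** The semidefinite constant term only increases the second eigenvalue, so the pencil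
    inherits coercivity from its linear part. *)
Lemma lambda2_pencil_min :
  exists t0, forall t, lambda2 (F0 + pencil t0) <= lambda2 (F0 + pencil t).
Proof.
have [c c_gt0 cP] := lambda2_pencil_coercive.
have cont := lambda2_pencil_continuous F0_herm.
pose phi t := lambda2 (F0 + pencil t).
have low t : c * `|t| <= phi t.
  apply: le_trans (cP t) _; rewrite -[leRHS]addr0.
  apply: lambda2_perturbation => // [||y]; rewrite ?adj_mxD ?F0_herm ?pencil_herm //.
  by rewrite qfD mul0r addr0 lerDr.
(* outside this ball coercivity gives more than the value at 0 *)
pose A := [set t : 'rV[R]_s.+1 | `|t| <= phi 0 / c]%classic.
have phi0 : 0 <= phi 0 by rewrite -[0](mulr0 c) -(normr0 'rV[R]_s.+1) low.
have [| | |t0 t0A t0P] := @EVT_min_rV R _ phi A.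
- by exists 0; rewrite /A /= normr0 divr_ge0 // ltW.
- apply: bounded_closed_compact.
    exists (phi 0 / c); split => // [|x x1 t]; first exact: num_real.
    by rewrite /A /= => /le_trans; apply; exact: ltW.
  exact: (closed_norm_preimage (@closed_le _ (phi 0 / c))).
- exact: continuous_subspaceT.
exists t0.
suff minP t : phi t0 <= phi t by exact: minP.
clearbody phi; case: (leP `|t| (phi 0 / c)) => [tA|lt_t].
  by apply: t0P; rewrite inE.
rewrite ltr_pdivrMr // mulrC in lt_t.
apply: le_trans (le_trans (ltW lt_t) (low t)).
by apply: t0P; rewrite inE /A /= normr0 divr_ge0 // ltW.
Qed.

End HermitianPencil.

(** * Kronecker products acting on matrices, and conjugation-symmetric blocks *)

Section KroneckerVectors.
Variable R : realType.
Local Notation C := R[i].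
Local Notation conj := (@Num.conj C).

(** Vectors of length [D n] are read as [D x n] matrices, so that [A *t B] acts as
    [X |-> A X B^T] and the blocks of a vector become rows. *)
Definition unvec D n (u : 'cV[C]_(D * n)) : 'M[C]_(D, n) :=
  \matrix_(i, j) u (mxtens_index (i, j)) 0.

Definition vec D n (X : 'M[C]_(D, n)) : 'cV[C]_(D * n) :=
  \col_i X (mxtens_unindex i).1 (mxtens_unindex i).2.

Lemma vecK D n : cancel (@vec D n) (@unvec D n).
Proof. by move=> X; apply/matrixP => i j; rewrite !mxE mxtens_indexK. Qed.

Lemma vecD D n (X Y : 'M[C]_(D, n)) : vec (X + Y) = vec X + vec Y.
Proof. by apply/colP => i; rewrite !mxE. Qed.

Lemma vecZ D n a (X : 'M[C]_(D, n)) : vec (a *: X) = a *: vec X.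
Proof. by apply/colP => i; rewrite !mxE. Qed.

Lemma unvecD D n (u v : 'cV[C]_(D * n)) : unvec (u + v) = unvec u + unvec v.
Proof. by apply/matrixP => i j; rewrite !mxE. Qed.

Lemma unvecZ D n a (u : 'cV[C]_(D * n)) : unvec (a *: u) = a *: unvec u.
Proof. by apply/matrixP => i j; rewrite !mxE. Qed.

Lemma unvec_conj D n (u : 'cV[C]_(D * n)) :
  unvec (conj_mx u) = conj_mx (unvec u).
Proof. by apply/matrixP => i j; rewrite !mxE. Qed.

Lemma sum_mxtens D n (F : 'I_(D * n) -> C) :
  \sum_i F i = \sum_i \sum_j F (mxtens_index (i, j)).
Proof.
rewrite pair_big_dep /= (reindex (@mxtens_index D n)) /=.
  by apply: eq_bigr => [[i j]].
by exists (@mxtens_unindex D n) => ? _; rewrite ?mxtens_indexK ?mxtens_unindexK.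
Qed.

Lemma dotc_unvec D n (u v : 'cV[C]_(D * n)) :
  dotc u v = dotc (unvec u) (unvec v).
Proof.
rewrite !dotcE sum_mxtens; apply: eq_bigr => i _; apply: eq_bigr => j _.
by rewrite big_ord1 !mxE.
Qed.

Lemma sqn_unvec D n (u : 'cV[C]_(D * n)) : sqn u = sqn (unvec u).
Proof. by apply: complexI; rewrite -!dotcc dotc_unvec. Qed.

Lemma unvec_tens D D' n n' (A : 'M[C]_(D', D)) (B : 'M[C]_(n', n))
    (u : 'cV[C]_(D * n)) :
  unvec ((A *t B) *m u) = A *m unvec u *m B^T.
Proof.
apply/matrixP => i j; rewrite !mxE sum_mxtens exchange_big /=.
apply: eq_bigr => l _; rewrite !mxE mulr_suml; apply: eq_bigr => p _.
by rewrite tensmxE !mxE mulrAC.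
Qed.

Lemma adj_mx_tens m n p q (A : 'M[C]_(m, n)) (B : 'M[C]_(p, q)) :
  adj_mx (A *t B) = adj_mx A *t adj_mx B.
Proof. by rewrite /adj_mx /conj_mx map_mxT trmx_tens. Qed.

Lemma dotc_adjr m n p (B : 'M[C]_(p, n)) (X : 'M[C]_(m, n)) (Y : 'M[C]_(m, p)) :
  dotc X (Y *m B) = dotc (X *m adj_mx B) Y.
Proof. by rewrite /dotc adj_mxM adj_mxK mulmxA mxtrace_mulC mulmxA. Qed.

Lemma dotc_conjE m n (X Y : 'M[C]_(m, n)) : dotc (conj_mx X) Y = \tr (X^T *m Y).
Proof. by rewrite /dotc /adj_mx conj_mxK. Qed.

(** The blocks commuting with the antilinear exchange [(y, z) |-> (conj z, conj y)]. *)
Definition conj_block N (J f : 'M[C]_N) : 'M[C]_(N + N) :=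
  block_mx J (conj_mx f) f (conj_mx J).

Lemma qf0 N (y : 'cV[C]_N) : qf 0 y = 0.
Proof. by rewrite /qf mul0mx /dotc mulmx0 mxtrace0. Qed.

Lemma conj_blockD N (J J' f f' : 'M[C]_N) :
  conj_block J f + conj_block J' f' = conj_block (J + J') (f + f').
Proof. by rewrite /conj_block add_block_mx !conj_mxD. Qed.

Lemma conj_blockZ N (a : R) (J f : 'M[C]_N) :
  a%:C *: conj_block J f = conj_block (a%:C *: J) (a%:C *: f).
Proof. by rewrite /conj_block scale_block_mx !conj_mxZ conj_real. Qed.

Lemma conj_block0 N : conj_block (0 : 'M[C]_N) 0 = 0.
Proof. by rewrite /conj_block !conj_mx0 block_mx0. Qed.

Lemma qf_conj_block N (J f : 'M[C]_N) (y z : 'cV[C]_N) : f^T = f ->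
  qf (conj_block J f) (col_mx y z)
  = qf J y + qf J (conj_mx z) + 2 * complex.Re (dotc z (f *m y)).
Proof.
move=> fsym; rewrite /qf mul_block_col dotc_col_mx !dotcDr !cReD.
have -> : complex.Re (dotc y (conj_mx f *m z)) = complex.Re (dotc z (f *m y)).
  by rewrite dotc_adj /adj_mx conj_mxK fsym -dotc_conj cRe_conj.
have -> : complex.Re (dotc z (conj_mx J *m z))
        = complex.Re (dotc (conj_mx z) (J *m conj_mx z)).
  by rewrite -cRe_conj -dotc_conj_mx conj_mxM conj_mxK.
move: (complex.Re _) (complex.Re _) (complex.Re _) => p q r; ring.
Qed.

Lemma conj_block_herm N (J f : 'M[C]_N) : adj_mx J = J -> f^T = f ->
  adj_mx (conj_block J f) = conj_block J f.
Proof.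
move=> Jherm fsym; rewrite /conj_block /adj_mx /conj_mx map_block_mx tr_block_mx.
congr block_mx.
- exact: Jherm.
- by rewrite -/(conj_mx f) -conj_mx_tr fsym.
- by rewrite -/(conj_mx (conj_mx f)) conj_mxK.
- by rewrite -/(conj_mx J) -/(conj_mx (conj_mx J)) -conj_mx_tr -/(adj_mx J) Jherm.
Qed.

Lemma conj_block_mul_conj N (J f : 'M[C]_N) (u : 'cV[C]_N) (l : R) :
  J *m u + conj_mx f *m conj_mx u = l%:C *: u ->
  conj_block J f *m col_mx u (conj_mx u) = l%:C *: col_mx u (conj_mx u).
Proof.
move=> uE; rewrite /conj_block mul_block_col scale_col_mx uE; congr col_mx.
by rewrite -[l%:C]conj_real -conj_mxZ -uE conj_mxD !conj_mxM !conj_mxK addrC.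
Qed.

Lemma qf_conj_block0 N (f : 'M[C]_N) (u : 'cV[C]_N) : f^T = f ->
  qf (conj_block 0 f) (col_mx u (conj_mx u))
  = 2 * complex.Re (dotc (conj_mx u) (f *m u)).
Proof. by move=> fsym; rewrite qf_conj_block // !qf0 !add0r. Qed.

(** The exchange [(y, z) |-> (conj z, conj y)] preserves the eigenspace; adding to [w]
    its image gives a fixed vector, which has the form [(u, conj u)]. *)
Lemma conj_swap_eigenvector N (J f : 'M[C]_N) (l : R) (w : 'cV[C]_(N + N)) :
  w != 0 -> conj_block J f *m w = l%:C *: w ->
  exists2 u : 'cV[C]_N, u != 0 &
    J *m u + conj_mx f *m conj_mx u = l%:C *: u.
Proof.
rewrite -[w]vsubmxK; move: (usubmx w) (dsubmx w) => y z yz_neq0.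
rewrite /conj_block mul_block_col scale_col_mx => /eq_col_mx[E1 E2].
have E2' : J *m conj_mx z + conj_mx f *m conj_mx y = l%:C *: conj_mx z.
  by rewrite -[l%:C]conj_real -conj_mxZ -E2 conj_mxD !conj_mxM conj_mxK addrC.
have [yz0|yz_sum] := eqVneq (y + conj_mx z) 0; last first.
  exists (y + conj_mx z) => //; rewrite conj_mxD conj_mxK !mulmxDr.
  by rewrite [conj_mx f *m _ + _]addrC addrACA E1 E2' -scalerDr.
have zE : conj_mx y = - z.
  by apply/eqP; rewrite -addr_eq0 -[z]conj_mxK -conj_mxD yz0 conj_mx0.
have ci : conj 'i%C = - 'i%C :> C by apply/eqP; rewrite eq_complex /= oppr0 !eqxx.
(* the symmetrization vanishes: the exchange maps [w] to [- w], so it fixes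
   [i w] *)
exists ('i%C *: y).
  rewrite scaler_eq0 negb_or; apply/andP; split.
    by rewrite eq_complex /= oner_eq0 andbF.
  apply: contraNneq yz_neq0 => y0; move: zE; rewrite y0 conj_mx0.
  by move/esym/eqP; rewrite oppr_eq0 => /eqP ->; rewrite col_mx0.
rewrite conj_mxZ ci zE scaleNr scalerN opprK -!scalemxAr -scalerDr E1.
by rewrite !scalerA mulrC.
Qed.

End KroneckerVectors.

(** * The weights and the real parameters *)

Section Scaling.
Variables (R : realType) (d : nat) (lam : R[i]).
Hypotheses (d_ge1 : (1 <= d)%N) (lam_neq0 : lam != 0).
Local Notation r := (Normc.normc lam).

Definition gammaR (p : 'I_d.+1) : R := complex.Re (gamma lam p).

Let r_gt0 : 0 < r.
Proof. by rewrite lt0r normc_eq0 lam_neq0 normc_ge0. Qed.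

Let rX_gt0 j : 0 < r ^+ j.
Proof. exact: exprn_gt0. Qed.

Lemma gammaE (p : 'I_d.+1) : gamma lam p = (gammaR p)%:C.
Proof. by rewrite /gammaR /gamma; case: ifP => // _; case: ifP. Qed.

Let den_gt0 j : 0 < 1 + r ^+ j.
Proof. by rewrite addr_gt0. Qed.

Lemma gammaR_gt0 (p : 'I_d.+1) : 0 < gammaR p.
Proof.
rewrite /gammaR /gamma; case: ifP => _; first by rewrite /= sqrtr_gt0 divr_gt0.
case: ifP => _ /=; last exact: ltr01.
by rewrite sqrtr_gt0 divr_gt0 // mulr_gt0.
Qed.

(** The first identity makes the weighted average over a palindromic pair an upper bound
    by the maximum; the second is what makes the two rows of an optimal pair have
    equal norm. *)
Lemma gammaR_sq_rev (p : 'I_d.+1) :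
  gammaR p ^+ 2 + gammaR (rev_ord p) ^+ 2 = 2
  /\ gammaR (rev_ord p) ^+ 2 * r ^+ p = gammaR p ^+ 2 * r ^+ rev_ord p.
Proof.
wlog: p / (p <= half_deg d)%N \/ p = rev_ord p => [base|].
  have [plo|phi] := leqP p (half_deg d); first exact: (base p (or_introl plo)).
  have [qlo|qhi] := leqP (rev_ord p) (half_deg d).
    have [] := base _ (or_introl qlo); rewrite rev_ordK addrC => -> ->.
    by split.
  apply: base; right; apply: val_inj; rewrite /= subSS.
  move: phi qhi; rewrite /half_deg /= subSS; have := ltn_ord p; lia.
case=> [plo|pE]; last first.
  have [p1 p2] : (p <= half_deg d)%N = false /\ (d - p <= half_deg d)%N = false.
    have := congr1 val pE; rewrite /= subSS /half_deg; have := ltn_ord p; lia.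
  by rewrite -pE /gammaR /gamma p1 p2 /= expr1n.
have pd : (p <= d)%N by rewrite -ltnS.
have Nq : ((rev_ord p : nat) <= half_deg d)%N = false.
  by rewrite /= subSS; rewrite /half_deg in plo *; lia.
have dq : (d - rev_ord p = p)%N by rewrite /= subSS subKn.
rewrite /gammaR /gamma plo Nq dq plo /gamma1 /gamma2 /=.
rewrite !sqr_sqrtr ?ltW ?divr_gt0 ?mulr_gt0 // subSS.
have -> : (d - p = p + (d - p.*2))%N by rewrite /half_deg in plo; lia.
rewrite exprD; move: (r ^+ (d - p.*2)) (rX_gt0 (d - p.*2)) => a a_gt0.
have : 1 + a != 0 by rewrite gt_eqF // addr_gt0.
by move=> a1; split; field.
Qed.

End Scaling.

Lemma val_inord d (p : 'I_(half_deg d).+1) : (inord p : 'I_d.+1) = p :> nat.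
Proof. by apply: inordK; have := ltn_ord p; rewrite /half_deg; lia. Qed.

Lemma val_rev d (p : 'I_d.+1) : rev_ord p = (d - p)%N :> nat.
Proof. by rewrite /= subSS. Qed.

Section SkewVectors.
Variables (R : realType) (d k : nat).
Local Notation C := R[i].
Local Notation D := (d.+1 + k)%N.
Local Notation m := (half_deg d).

Definition skew (g : 'cV[C]_D) : Prop :=
  forall p, g (lshift k (rev_ord p)) 0 = - g (lshift k p) 0.

(** The vector [g] with [f = fmx_of g]: one coefficient for each palindromic pair. *)
Definition skew_vec (c : 'I_m.+1 -> C) : 'cV[C]_D :=
  \sum_p c p *: (evec R k (inord p) - evec R k (rev_ord (inord p))).

Definition coefs (t : 'rV[R]_(m.*2.+1)) (p : 'I_m.+1) : C :=
  if (p < m)%N then t 0 (inord p.*2) +i* t 0 (inord p.*2.+1)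
  else (t 0 (inord m.*2))%:C.

Lemma evecE (p q : 'I_d.+1) : evec R k p (lshift k q) 0 = (q == p)%:R.
Proof. by rewrite mxE eqxx andbT (inj_eq (@lshift_inj _ _)). Qed.

Lemma skew_vecE (c : 'I_m.+1 -> C) (q : 'I_d.+1) :
  skew_vec c (lshift k q) 0
  = \sum_p c p * ((q == inord p)%:R - (q == rev_ord (inord p))%:R).
Proof.
have subE (u v : 'cV[C]_D) i : (u - v) i 0 = u i 0 - v i 0 by rewrite !mxE.
by rewrite /skew_vec summxE; apply: eq_bigr => p _; rewrite mxE subE !evecE.
Qed.

Lemma skew_vec_skew (c : 'I_m.+1 -> C) : skew (skew_vec c).
Proof.
move=> q; rewrite !skew_vecE -sumrN; apply: eq_bigr => p _; rewrite -mulrN opprB.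
by rewrite -{1}[inord p]rev_ordK !(inj_eq rev_ord_inj).
Qed.

Lemma skew_vec_coord (d_ge1 : (1 <= d)%N) (c : 'I_m.+1 -> C) (p : 'I_m.+1) :
  skew_vec c (lshift k (inord p)) 0 = c p.
Proof.
have rev_neq (p' : 'I_m.+1) : (inord p == rev_ord (inord p') :> 'I_d.+1) = false.
  apply/negbTE/eqP => /(congr1 (@nat_of_ord _)); rewrite val_rev !val_inord.
  move: (ltn_ord p) (ltn_ord p') d_ge1; rewrite /half_deg.
  by move: (p : nat) (p' : nat) => x y; clear; lia.
rewrite skew_vecE (bigD1 p) //= eqxx rev_neq subr0 mulr1 big1 ?addr0 // => p' p'p.
have /negPf-> : inord p != inord p' :> 'I_d.+1.
  apply: contra p'p => /eqP /(congr1 (@nat_of_ord _)); rewrite !val_inord.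
  by move=> /val_inj ->.
by rewrite rev_neq subrr mulr0.
Qed.

Lemma skew_vecD (c c' : 'I_m.+1 -> C) :
  skew_vec (fun p : 'I_m.+1 => c p + c' p) = skew_vec c + skew_vec c' :> 'cV[C]__.
Proof. by rewrite /skew_vec -big_split; apply: eq_bigr => p _; rewrite scalerDl. Qed.

Lemma skew_vecZ a (c : 'I_m.+1 -> C) :
  skew_vec (fun p : 'I_m.+1 => a * c p) = a *: skew_vec c :> 'cV[C]__.
Proof. by rewrite /skew_vec scaler_sumr; apply: eq_bigr => p _; rewrite scalerA. Qed.

Lemma eq_skew_vec (c c' : 'I_m.+1 -> C) : c =1 c' -> skew_vec c = skew_vec c'.
Proof. by move=> cc'; apply: eq_bigr => p _; rewrite cc'. Qed.

Lemma coefs_neq0 (t : 'rV[R]_(m.*2.+1)) : t != 0 -> exists p, coefs t p != 0.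
Proof.
move=> t_neq0.
have /existsP[i ti] : [exists i, t 0 i != 0].
  rewrite -[X in is_true X]negbK negb_exists; apply/negP => /forallP t0.
  case/eqP: t_neq0; apply/rowP => i; rewrite mxE; apply/eqP.
  by rewrite -[_ == _]negbK t0.
have im : (i./2 < m.+1)%N by have := ltn_ord i; lia.
exists (Ordinal im); rewrite /coefs /=; case: ifP => im2; last first.
  have -> : inord m.*2 = i by apply: val_inj; rewrite /= inordK; have := ltn_ord i; lia.
  by rewrite -(rmorph0 (real_complex R)) (inj_eq (@complexI _)).
rewrite eq_complex /= negb_and; have := odd_double_half i; case: (odd i) => iE.
  have -> : inord (i./2).*2.+1 = i by rewrite -[RHS]inord_val -[in RHS]iE.
  by rewrite ti orbT.
have -> : inord (i./2).*2 = i by rewrite -[RHS]inord_val -[in RHS]iE.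
by rewrite ti.
Qed.

Lemma coefs_surj (c : 'I_m.+1 -> C) : complex.Im (c ord_max) = 0 ->
  exists t : 'rV[R]_(m.*2.+1), coefs t =1 c.
Proof.
move=> cm; exists (\row_i (if odd i then complex.Im (c (inord i./2))
                           else complex.Re (c (inord i./2)))).
move=> p; rewrite /coefs; case: ifP => pm.
  have p1 : (p.*2 < m.*2.+1)%N by lia.
  have p2 : (p.*2.+1 < m.*2.+1)%N by lia.
  rewrite !mxE !inordK //= odd_double /= doubleK uphalf_double inord_val.
  by case: (c p).
have -> : p = ord_max by apply: val_inj => /=; have := ltn_ord p; lia.
rewrite mxE inordK // odd_double doubleK.
have -> : inord m = ord_max :> 'I_m.+1 by apply: val_inj; rewrite /= inordK.
by case: (c ord_max) cm => a b /= ->.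
Qed.

Lemma palindromic_index (d_ge1 : (1 <= d)%N) (p : 'I_d.+1) :
  (exists j : 'I_m.+1, p = inord j \/ rev_ord p = inord j) \/ rev_ord p = p.
Proof.
have [plo|phi] := ltnP p m.+1.
  left; exists (Ordinal plo); left; apply: val_inj.
  by rewrite [RHS]val_inord.
have [qlo|qhi] := ltnP (rev_ord p) m.+1.
  left; exists (Ordinal qlo); right; apply: val_inj.
  by rewrite [RHS]val_inord.
right; apply: ord_inj; rewrite [LHS]val_rev; rewrite val_rev in qhi.
move: phi qhi (ltn_ord p); rewrite /half_deg; move: (p : nat) => x.
by move: d_ge1; clear; lia.
Qed.

End SkewVectors.

(** * The matrices J, f and F in terms of rows *)

Lemma tens1mx1 (K : comRingType) m n :
  (1%:M : 'M[K]_m) *t (1%:M : 'M_n) = 1%:M.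
Proof.
apply/matrixP => i j; case: (mxtens_indexP i) => i0 i1.
case: (mxtens_indexP j) => j0 j1; rewrite tensmxE !mxE -natrM mulnb.
by rewrite (can_eq (@mxtens_indexK m n)) -pair_eqE.
Qed.

Section Pencil.
Variables (R : realType) (n d k : nat) (G : rmp R n d k) (lam : R[i]).
Local Notation C := R[i].
Local Notation conj := (@Num.conj C).
Hypotheses (d_ge1 : (1 <= d)%N) (lam_neq0 : lam != 0).
Local Notation D := (d.+1 + k)%N.
Local Notation M := (Minv G lam).
Local Notation Lam := (Lambda G lam).
Local Notation J := (Jmx G lam).
Local Notation Gi := (invmx (Gamma n d k lam)).
Local Notation m := (half_deg d).

(** The diagonal of [Gamma]: the weight on the row [q]. *)
Definition block_scale (q : 'I_D) : R :=
  match split q with inl p => gammaR lam p | inr _ => 1 end.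

Lemma block_scale_lshift p : block_scale (lshift k p) = gammaR lam p.
Proof. by rewrite /block_scale (unsplitK (inl p)). Qed.

Lemma block_scale_rshift j : block_scale (rshift d.+1 j) = 1.
Proof. by rewrite /block_scale (unsplitK (inr j)). Qed.

Lemma block_scale_gt0 q : 0 < block_scale q.
Proof. by rewrite /block_scale; case: split => // p; exact: gammaR_gt0. Qed.

Definition block_scale_inv : 'M[C]_D := diag_mx (\row_q ((block_scale q)^-1)%:C).

Lemma Gamma_mul_block_scale_inv : Gamma n d k lam *m (block_scale_inv *t 1%:M) = 1%:M.
Proof.
have -> : Gamma n d k lam = diag_mx (\row_q (block_scale q)%:C) *t 1%:M.
  congr (diag_mx _ *t _); apply/rowP => q; rewrite [RHS]mxE.
  by case: (split_ordP q) => p ->;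
    rewrite ?row_mxEl ?row_mxEr mxE ?block_scale_lshift ?block_scale_rshift ?gammaE.
rewrite tensmx_mul mulmx1 -tens1mx1; congr (_ *t _).
rewrite /block_scale_inv mulmx_diag; apply/matrixP => i j; rewrite !mxE.
by rewrite -rmorphM /= divff // (gt_eqF (block_scale_gt0 i)).
Qed.

Lemma Gamma_unit : Gamma n d k lam \in unitmx.
Proof. by have [] := mulmx1_unit Gamma_mul_block_scale_inv. Qed.

Lemma invGammaE : Gi = block_scale_inv *t 1%:M.
Proof. by rewrite -[LHS]mulmx1 -Gamma_mul_block_scale_inv mulKmx // Gamma_unit. Qed.

Lemma block_scale_inv_inj p : injective (fun Y : 'M[C]_(D, p) => block_scale_inv *m Y).
Proof.
move=> Y Z /= /matrixP YZ; apply/matrixP => i j; have := YZ i j.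
rewrite !mul_diag_mx !mxE; apply: mulfI.
rewrite -(rmorph0 (real_complex R)) (inj_eq (@complexI _)) invr_eq0.
by rewrite gt_eqF ?block_scale_gt0.
Qed.

Lemma block_scale_inv_tr : block_scale_inv^T = block_scale_inv.
Proof. exact: tr_diag_mx. Qed.

Lemma block_scale_inv_conj : conj_mx block_scale_inv = block_scale_inv.
Proof.
rewrite /conj_mx map_diag_mx; congr diag_mx; apply/rowP => q.
by rewrite !mxE /= conj_real.
Qed.

Lemma invGamma_tr : Gi^T = Gi.
Proof. by rewrite invGammaE trmx_tens block_scale_inv_tr trmx1. Qed.

Lemma invGamma_conj : conj_mx Gi = Gi.
Proof.
rewrite invGammaE /conj_mx map_mxT -/(conj_mx _) block_scale_inv_conj.
by rewrite map_mx1.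
Qed.

Lemma invGamma_adj : adj_mx Gi = Gi.
Proof. by rewrite /adj_mx invGamma_conj invGamma_tr. Qed.

Lemma unvec_invGamma (u : 'cV[C]_(D * n)) :
  unvec (Gi *m u) = block_scale_inv *m unvec u.
Proof. by rewrite invGammaE unvec_tens trmx1 mulmx1. Qed.

Lemma invGamma_conjugate (K : 'M[C]_(D * n)) (u : 'cV[C]_(D * n)) :
  Gi *m K *m Gi *m u = Gi *m (K *m (Gi *m u)).
Proof. by rewrite !mulmxA. Qed.

(** The row [x^T] of the vector [x] determined by the vectors to which it is sent. *)
Definition image_row (X : 'M[C]_(D, n)) : 'rV[C]_n := Lam *m X *m M^T.

Lemma unvec_Jmx (u : 'cV[C]_(D * n)) :
  unvec (J *m u)
  = block_scale_inv *m (adj_mx Lam *m (image_row (unvec (Gi *m u)) *m conj_mx M)).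
Proof.
rewrite /Jmx invGamma_conjugate [LHS]unvec_invGamma.
by rewrite unvec_tens trmx_mul /adj_mx trmxK /image_row !mulmxA.
Qed.

Lemma Jmx_herm : adj_mx J = J.
Proof.
by rewrite /Jmx !adj_mxM adj_mx_tens !adj_mxM !adj_mxK invGamma_adj mulmxA.
Qed.

(** [J] measures [x]: in the scaled variables its form is [|x|^2]. *)
Lemma qf_Jmx u : qf J u = sqn (image_row (unvec (Gi *m u))).
Proof.
rewrite /qf dotc_unvec unvec_Jmx dotc_adj {1}/adj_mx.
rewrite block_scale_inv_conj block_scale_inv_tr.
rewrite -unvec_invGamma; set X := unvec _.
rewrite dotc_adj adj_mxK dotc_adjr.
have -> : adj_mx (conj_mx M) = M^T by rewrite /adj_mx conj_mxK.
by rewrite -/(image_row X) dotcc.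
Qed.

(** The common form of the matrices [S_p] and of their linear combinations, linear in
    the vector [g]. *)
Definition fmx_of (g : 'cV[C]_D) : 'M[C]_(D * n) :=
  Gi *m ((g *m Lam) *t M + ((g *m Lam) *t M)^T) *m Gi.

Lemma fmx_of_sym g : (fmx_of g)^T = fmx_of g.
Proof.
have trD (A B : 'M[C]_(D * n)) : (A + B)^T = A^T + B^T by exact: linearD.
by rewrite /fmx_of !trmx_mul invGamma_tr trD trmxK addrC mulmxA.
Qed.

Lemma tensmxDl m p q s (A A' : 'M[C]_(m, p)) (B : 'M[C]_(q, s)) :
  (A + A') *t B = A *t B + A' *t B.
Proof. by apply/matrixP => i j; rewrite !mxE mulrDl. Qed.

Lemma tensmxZl m p q s a (A : 'M[C]_(m, p)) (B : 'M[C]_(q, s)) :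
  (a *: A) *t B = a *: (A *t B).
Proof. by apply/matrixP => i j; rewrite !mxE mulrA. Qed.

Lemma fmx_ofD g g' : fmx_of (g + g') = fmx_of g + fmx_of g'.
Proof.
have trD (A B : 'M[C]_(D * n)) : (A + B)^T = A^T + B^T by exact: linearD.
by rewrite /fmx_of mulmxDl tensmxDl trD addrACA mulmxDr mulmxDl.
Qed.

Lemma fmx_ofZ a g : fmx_of (a *: g) = a *: fmx_of g.
Proof.
have trZ (A : 'M[C]_(D * n)) : (a *: A)^T = a *: A^T by exact: linearZ.
by rewrite /fmx_of -scalemxAl tensmxZl trZ -scalerDr -scalemxAr -scalemxAl.
Qed.

Lemma fmx_of0 : fmx_of 0 = 0.
Proof. by rewrite -(scale0r 0) fmx_ofZ scale0r. Qed.

Lemma fmx_of_sum (I : Type) (s : seq I) (g : I -> 'cV[C]_D) :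
  fmx_of (\sum_(i <- s) g i) = \sum_(i <- s) fmx_of (g i).
Proof. by elim/big_rec2: _ => [|i x y _ <-]; rewrite ?fmx_of0 ?fmx_ofD. Qed.

Lemma unvec_fmx_of g u : let X := unvec (Gi *m u) in
  unvec (fmx_of g *m u)
  = block_scale_inv *m (g *m image_row X + Lam^T *m (g^T *m X *m M)).
Proof.
move=> X; rewrite /fmx_of invGamma_conjugate [LHS]unvec_invGamma.
rewrite mulmxDl unvecD trmx_tens !unvec_tens trmxK trmx_mul /image_row -/X.
by rewrite !mulmxA.
Qed.

Lemma fmx_of_mul_eq0 g u : let X := unvec (Gi *m u) in
  fmx_of g *m u = 0 -> g *m image_row X + Lam^T *m (g^T *m X *m M) = 0.
Proof.
move=> X fu0; apply: block_scale_inv_inj; rewrite /= mulmx0 -unvec_fmx_of fu0.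
by apply/matrixP => i j; rewrite !mxE.
Qed.

(** The left-hand side is [u^T f u], so the constraints are equations between the
    products of the rows with [x]. *)
Lemma dotc_conj_fmx_of g u : let X := unvec (Gi *m u) in
  dotc (conj_mx u) (fmx_of g *m u) = 2 * dotc (conj_mx (g^T *m X)) (image_row X).
Proof.
move=> X; rewrite dotc_unvec unvec_fmx_of dotc_adj {1}/adj_mx.
rewrite block_scale_inv_conj block_scale_inv_tr.
have -> : block_scale_inv *m unvec (conj_mx u) = conj_mx X.
  by rewrite /X unvec_invGamma conj_mxM block_scale_inv_conj unvec_conj.
rewrite dotcDr mulr_natl mulr2n; congr (_ + _).
  by rewrite dotc_adj /adj_mx -conj_mx_tr -conj_mxM.
rewrite !dotc_conjE trmx_mul trmxK -[RHS]mxtrace_tr /image_row !trmx_mul !trmxK.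
by rewrite !mulmxA [LHS]mxtrace_mulC !mulmxA.
Qed.

Lemma SmxE p : Smx G lam p = fmx_of (evec R k p - evec R k (rev_ord p)).
Proof.
apply: (congr1 (fun K => Gi *m K *m Gi)); rewrite /Ctilde.
have trD (A B : 'M[C]_(D * n)) : (A + B)^T = A^T + B^T by exact: linearD.
have trN (A : 'M[C]_(D * n)) : (- A)^T = - A^T by exact: linearN.
rewrite mulmxDl mulNmx tensmxDl -[- (_ *m _)]scaleN1r tensmxZl scaleN1r.
rewrite !trD !trN !trmx_tens !trmx_mul !trmxK.
by rewrite addrC addrACA [- _ - _]addrC addrACA [X in X + _]addrC addrACA.
Qed.

Definition Fmx_of g := conj_block J (fmx_of g).

Lemma Fmx_of_herm g : adj_mx (Fmx_of g) = Fmx_of g.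
Proof. by apply: conj_block_herm; [exact: Jmx_herm | exact: fmx_of_sym]. Qed.

Lemma fmxE t : fmx G lam t = fmx_of (skew_vec k (coefs t)).
Proof.
rewrite /skew_vec fmx_of_sum big_ord_recr /= fmx_ofZ -SmxE /coefs ltnn.
congr (_ + _); apply: eq_bigr => p _.
by rewrite fmx_ofZ -SmxE /= ltn_ord.
Qed.

Lemma FmxE t : Fmx G lam t = Fmx_of (skew_vec k (coefs t)).
Proof. by rewrite /Fmx_of -fmxE. Qed.

End Pencil.

(** * Existence of a global minimum *)

Lemma linear_form_comb (R : realType) N (f : 'M[R[i]]_N) (a b z z' : 'cV_N) s t :
  dotc a (s *: z + t *: z') + dotc b (f *m (s *: z + t *: z'))
  = (dotc a z + dotc b (f *m z)) * s + (dotc a z' + dotc b (f *m z')) * t.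
Proof.
rewrite mulmxDr -!scalemxAr !dotcDr !dotcZr.
move: (dotc a z) (dotc a z') (dotc b _) (dotc b _) => a1 a2 b1 b2; ring.
Qed.

Lemma dim_gt1 d k n : (0 < n)%N -> (1 < (d.+1 + k) * n + (d.+1 + k) * n)%N.
Proof. by rewrite addSn; case: n => // n _; lia. Qed.

Section RankTwo.
Variables (R : realType) (n d k : nat) (G : rmp R n d k) (lam : R[i]).
Local Notation C := R[i].
Hypotheses (n_gt0 : (0 < n)%N) (d_ge1 : (1 <= d)%N) (lam_neq0 : lam != 0).
Hypotheses (lam_neq1 : lam != 1) (lam_neqN1 : lam != -1).
Hypothesis G_unit : rmp_eval G lam \in unitmx.
Local Notation D := (d.+1 + k)%N.
Local Notation N := (D * n)%N.
Local Notation M := (Minv G lam).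
Local Notation Lam := (Lambda G lam).
Local Notation m := (half_deg d).

Lemma LamE_lshift p : Lam 0 (lshift k p) = lam ^+ p.
Proof. by rewrite row_mxEl mxE. Qed.

(** If [g] were a multiple of [Lambda^T], then [lam ^ (d - p) = - lam ^ p] for all [p];
    the indices 0 and 1 then force [lam ^ 2 = 1]. *)
Lemma skew_Lambda_minor (g : 'cV[C]_D) : skew g -> g != 0 ->
  exists q, g q 0 != Lam 0 q * g (lshift k 0) 0.
Proof.
move=> ganti g_neq0; apply/existsP; rewrite -[X in is_true X]negbK negb_exists.
apply/negP => /forallP gE.
have {}gE q : g q 0 = Lam 0 q * g (lshift k 0) 0.
  by apply/eqP; have := gE q; rewrite negbK.
set g0 := g (lshift k 0) 0 in gE.
have g0_neq0 : g0 != 0.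
  apply: contra_neq g_neq0 => g00; apply/colP => q.
  by rewrite gE g00 mulr0 mxE.
have pw (p : 'I_d.+1) : lam ^+ rev_ord p = - lam ^+ p.
  have := ganti p; rewrite !gE !LamE_lshift => /eqP.
  by rewrite -mulNr => /eqP /(mulIf g0_neq0).
have := pw 0; rewrite /= expr0 subn1 /= => pd.
have d1 : (1 < d.+1)%N by [].
have := pw (Ordinal d1); rewrite /= subSS subn1 expr1 => pd1.
(* the entries 0 and 1 give [lam ^ d = -1] and [lam ^ d = - lam ^ 2] *)
have pS : lam ^+ d = lam * lam ^+ d.-1 by rewrite -exprS prednK.
have : lam ^+ 2 = 1.
  by apply: oppr_inj; rewrite -pd pS pd1 mulrN expr2.
move/eqP; rewrite sqrf_eq1 (negPf lam_neq1) (negPf lam_neqN1) //.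
Qed.

(** The matrix [fmx_of g] does not vanish on any hyperplane, that is, its rank is at
    least 2. The functional is written in the form needed for vectors [(v, f v)]. *)
Lemma fmx_of_rank2 (g : 'cV[C]_D) (a b : 'cV[C]_N) : skew g -> g != 0 ->
  exists v, dotc a v + dotc b (fmx_of G lam g *m v) = 0 /\ fmx_of G lam g *m v != 0.
Proof.
move=> ganti g_neq0; have [q gq] := skew_Lambda_minor ganti g_neq0.
pose f := fmx_of G lam g; pose o := lshift k (0 : 'I_d.+1).
pose bb : 'rV[C]_n := delta_mx 0 (Ordinal n_gt0).
(* [o] and [q] are the rows of a nonzero minor of [(Lambda^T, g)], so on the
   span of these two unit vectors [Lambda w] and [g^T w] determine [w] *)
pose w (x y : C) : 'cV[C]_D := x *: delta_mx o 0 + y *: delta_mx q 0.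
pose v x y := Gamma n d k lam *m vec (w x y *m bb).
pose ell (z : 'cV[C]_N) := dotc a z + dotc b (f *m z).
have [x [y [xy0 xyE]]] := kernel_pair (ell (v 1 0)) (ell (v 0 1)).
have vE : v x y = x *: v 1 0 + y *: v 0 1.
  rewrite /v /w !scale1r !scale0r addr0 add0r mulmxDl -!scalemxAl vecD !vecZ.
  by rewrite mulmxDr -!scalemxAr.
exists (v x y); split.
  by rewrite -[RHS]xyE vE; exact: linear_form_comb.
apply: contraTneq xy0 => /(fmx_of_mul_eq0 lam_neq0).
rewrite {1 2}/v mulKmx ?Gamma_unit // vecK negb_or !negbK => /matrixP K0.
pose lw := x + y * Lam 0 q; pose gw := x * g o 0 + y * g q 0.
have mul_w p (B : 'M[C]_(p, D)) i :
    (B *m w x y) i 0 = x * B i o + y * B i q.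
  by rewrite /w mulmxDr -!scalemxAr -!colE !mxE.
have Lam_o : Lam 0 o = 1 by rewrite LamE_lshift expr0.
have xiE : image_row G lam (w x y *m bb) = lw *: (bb *m M^T).
  rewrite /image_row !mulmxA -mulmxA [Lam *m _]mx11_scalar mul_w Lam_o mulr1.
  by rewrite mul_scalar_mx.
have gE : g^T *m (w x y *m bb) *m M = gw *: (bb *m M).
  rewrite !mulmxA -mulmxA [g^T *m _]mx11_scalar mul_w.
  by rewrite mul_scalar_mx ![g^T _ _]mxE.
have {}K0 i j : g i 0 * lw * (bb *m M^T) 0 j + Lam 0 i * gw * (bb *m M) 0 j = 0.
  have := K0 i j; rewrite xiE gE -!scalemxAr [in RHS]mxE => <-.
  have scE (A : 'M[C]_(D, n)) c : (c *: A) i j = c * A i j by rewrite mxE.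
  rewrite [RHS]mxE !scE [(g *m _) _ _]mxE [(Lam^T *m _) _ _]mxE.
  rewrite !big_ord1 [Lam^T _ _]mxE.
  move: (bb *m M^T) (bb *m M) (Lam 0 i) (g i 0) => u1 u2 l1 g1.
  move: (u1 0 j) (u2 0 j) => c1 c2; clearbody lw gw; ring.
have bb_neq0 : bb != 0.
  by apply/eqP => /rowP/(_ (Ordinal n_gt0))/eqP; rewrite !mxE !eqxx oner_eq0.
have Munit : M \in unitmx by rewrite unitmx_inv.
have nz_entry (B : 'M[C]_n) : B \in unitmx -> exists j, (bb *m B) 0 j != 0.
  move=> Bu; apply/existsP; rewrite -[X in is_true X]negbK negb_exists.
  apply/negP => /forallP B0; case/eqP: bb_neq0.
  rewrite -[bb](mulmxK Bu) (_ : bb *m B = 0) ?mul0mx //.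
  by apply/rowP => j; rewrite [RHS]mxE; apply/eqP; rewrite -[_ == _]negbK B0.
have lw0 : lw = 0.
  have [|j /negPf j0] := nz_entry M^T; first by rewrite unitmx_tr.
  have : (g q 0 - Lam 0 q * g o 0) * lw * (bb *m M^T) 0 j = 0.
    have := K0 o j; have := K0 q j; rewrite Lam_o.
    move: (bb *m M^T) (bb *m M) => u1 u2; move: (u1 0 j) (u2 0 j) => c1 c2.
    clearbody lw gw; move: (Lam 0 q) (g q 0) (g o 0) => l1 g1 g2 Kq Ko.
    have -> : (g1 - l1 * g2) * lw * c1
        = g1 * lw * c1 + l1 * gw * c2 - l1 * (g2 * lw * c1 + 1 * gw * c2).
      by ring.
    by rewrite Kq Ko mulr0 subrr.
  move/eqP; rewrite !mulf_eq0 subr_eq0 (negPf gq) j0 orbF => /eqP //.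
have gw0 : gw = 0.
  have [j /negPf j0] := nz_entry M Munit; have := K0 o j.
  rewrite lw0 mulr0 mul0r add0r Lam_o mul1r => /eqP.
  by rewrite mulf_eq0 j0 orbF => /eqP.
have y0 : y = 0.
  have : y * (g q 0 - Lam 0 q * g o 0) = 0.
    rewrite -[RHS](subrr 0) -{1}gw0 -(mul0r (g o 0)) -lw0 /gw /lw.
    by move: (g o 0) (g q 0) (Lam 0 q) => *; ring.
  by move/eqP; rewrite mulf_eq0 subr_eq0 (negPf gq) orbF => /eqP.
by move: lw0; rewrite /lw y0 mul0r addr0 => ->; rewrite eqxx.
Qed.
End RankTwo.

Section GlobalMinimum.
Variables (R : realType) (n d k : nat) (G : rmp R n d k) (lam : R[i]).
Local Notation C := R[i].
Hypotheses (n_gt0 : (0 < n)%N) (d_ge1 : (1 <= d)%N) (lam_neq0 : lam != 0).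
Hypotheses (lam_neq1 : lam != 1) (lam_neqN1 : lam != -1).
Hypothesis G_unit : rmp_eval G lam \in unitmx.
Local Notation D := (d.+1 + k)%N.
Local Notation N := (D * n)%N.
Local Notation M := (Minv G lam).
Local Notation J := (Jmx G lam).
Local Notation m := (half_deg d).

Lemma fmxD t t' : fmx G lam (t + t') = fmx G lam t + fmx G lam t'.
Proof.
rewrite !fmxE -fmx_ofD -skew_vecD; congr fmx_of; apply: eq_skew_vec => p.
by rewrite /coefs; case: ifP => _; rewrite !mxE // rmorphD.
Qed.

Lemma fmxZ (a : R) t : fmx G lam (a *: t) = a%:C *: fmx G lam t.
Proof.
rewrite !fmxE -fmx_ofZ -skew_vecZ; congr fmx_of; apply: eq_skew_vec => p.
rewrite /coefs; case: ifP => _; rewrite !mxE ?rmorphM //.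
by apply/eqP; rewrite eq_complex /= !mul0r subr0 addr0 !eqxx.
Qed.

Lemma fmx_sym t : (fmx G lam t)^T = fmx G lam t.
Proof. by rewrite fmxE fmx_of_sym. Qed.

Let B i := conj_block 0 (fmx G lam (delta_mx 0 i)).

Lemma fmx_pencil t : conj_block 0 (fmx G lam t) = pencil B t.
Proof.
rewrite {1}(row_sum_delta t) /pencil.
have fD u v : conj_block 0 (fmx G lam (u + v))
            = conj_block 0 (fmx G lam u) + conj_block 0 (fmx G lam v).
  by rewrite fmxD conj_blockD addr0.
have f0 : conj_block 0 (fmx G lam 0) = 0.
  by rewrite -(scale0r (0 : 'rV[R]_(m.*2.+1))) fmxZ scale0r conj_block0.
rewrite (big_morph (fun u => conj_block 0 (fmx G lam u)) fD f0).
by apply: eq_bigr => i _; rewrite fmxZ /B conj_blockZ scaler0.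
Qed.

Lemma Fmx_pencil t : Fmx G lam t = conj_block J 0 + pencil B t.
Proof. by rewrite -fmx_pencil conj_blockD addr0 add0r. Qed.

(** The form on [(v, f v)] is [2 |f v|^2], and such vectors meet every hyperplane with
    [f v <> 0]. *)
Lemma fmx_lambda2_gt0 t : t != 0 -> 0 < lambda2 (conj_block 0 (fmx G lam t)).
Proof.
move=> /coefs_neq0[p cp]; apply: Courant_Fischer_gt => [||e].
- by apply: conj_block_herm; [exact: adj_mx0 | exact: fmx_sym].
- exact: dim_gt1.
have g_neq0 : skew_vec k (coefs t) != 0.
  by apply: contraNneq cp => g0; rewrite -(skew_vec_coord k d_ge1) g0 mxE.
have [v [ev fv]] := fmx_of_rank2 n_gt0 d_ge1 lam_neq0 lam_neq1 lam_neqN1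
  G_unit (usubmx e) (dsubmx e) (skew_vec_skew _ _) g_neq0.
rewrite -fmxE // in ev fv.
exists (col_mx v (fmx G lam t *m v)); rewrite mul0r -[e]vsubmxK dotc_col_mx.
split => //; rewrite qf_conj_block ?fmx_sym // !qf0 !add0r dotcc /=.
by rewrite mulr_gt0 // sqn_gt0.
Qed.

Lemma psi_min : exists t0, forall t, psi G lam t0 <= psi G lam t.
Proof.
have [|||||t0 t0P] := @lambda2_pencil_min R _ _ (conj_block J 0) B; last first.
- by exists t0 => t; rewrite /psi !Fmx_pencil.
- by move=> t t_neq0; rewrite -fmx_pencil fmx_lambda2_gt0.
- move=> y; rewrite -[y]vsubmxK qf_conj_block ?trmx0 // mul0mx.
  by rewrite /dotc mulmx0 mxtrace0 mulr0 addr0 !qf_Jmx // addr_ge0 ?sqn_ge0.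
- by move=> i; apply: conj_block_herm; [exact: adj_mx0 | exact: fmx_sym].
- by apply: conj_block_herm; rewrite ?trmx0 ?Jmx_herm.
- exact: dim_gt1.
Qed.

End GlobalMinimum.

(** * The lower bound *)

Lemma dotc_conj_row (R : realType) n (u v : 'rV[R[i]]_n) :
  dotc (conj_mx u) v = (u *m v^T) 0 0.
Proof.
by rewrite dotc_conjE mxtrace_mulC -mxtrace_tr trmx_mul trmxK trace_mx11.
Qed.

Lemma sum_rows_sqn (R : realType) p n (X : 'M[R[i]]_(p, n)) :
  sqn X = \sum_q sqn (row q X).
Proof.
apply: eq_bigr => q _; rewrite /sqn big_ord1.
by apply: eq_bigr => j _; rewrite mxE.
Qed.

Section LowerBound.
Variables (R : realType) (n d k : nat) (G : rmp R n d k) (lam : R[i]).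
Local Notation C := R[i].
Local Notation conj := (@Num.conj C).
Local Notation sq z := (Normc.normc z ^+ 2).
Hypotheses (n_gt0 : (0 < n)%N) (d_ge1 : (1 <= d)%N) (lam_neq0 : lam != 0).
Local Notation D := (d.+1 + k)%N.
Local Notation N := (D * n)%N.
Local Notation M := (Minv G lam).
Local Notation Gi := (invmx (Gamma n d k lam)).
Local Notation m := (half_deg d).

(** Both indices of a pair carry the same [f], and their weights have mean 1. *)
Lemma gammaR_average (f : 'I_d.+1 -> R) : (forall p, f (rev_ord p) = f p) ->
  \sum_p gammaR lam p ^+ 2 * f p = \sum_p f p.
Proof.
move=> f_rev; apply: (@mulfI _ 2); rewrite ?pnatr_eq0 //.
rewrite [LHS]mulr_natl mulr2n {2}(reindex_inj rev_ord_inj) -big_split mulr_sumr.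
apply: eq_bigr => p _; rewrite /= f_rev -mulrDl.
by have [-> _] := gammaR_sq_rev d_ge1 lam_neq0 p.
Qed.

Lemma row_block_scale_inv p (Y : 'M[C]_(D, p)) q :
  row q (block_scale_inv d k lam *m Y) = ((block_scale lam q)^-1)%:C *: row q Y.
Proof. by apply/rowP => j; rewrite mxE mul_diag_mx !mxE. Qed.

Lemma sqn_scaled_rows u : sqn u
  = \sum_p gammaR lam p ^+ 2 * sqn (row (lshift k p) (unvec (Gi *m u)))
    + \sum_j sqn (row (rshift d.+1 j) (unvec (Gi *m u))).
Proof.
rewrite sqn_unvec sum_rows_sqn big_split_ord /=.
have rowE q : sqn (row q (unvec u))
    = block_scale lam q ^+ 2 * sqn (row q (unvec (Gi *m u))).
  rewrite unvec_invGamma // row_block_scale_inv sqnZ normc_real.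
  rewrite -normrX ger0_norm ?sqr_ge0 // exprVn mulrA divff ?mul1r //.
  by rewrite expf_neq0 // gt_eqF // block_scale_gt0.
congr (_ + _); apply: eq_bigr => q _; rewrite rowE.
  by rewrite block_scale_lshift.
by rewrite block_scale_rshift expr1n mul1r.
Qed.

(** The constraints [x^T v_p = x^T v_(d-p)] which a palindromic tuple imposes. *)
Definition pal_rows (X : 'M[C]_(D, n)) : Prop := forall p : 'I_d.+1,
  row (lshift k p) X *m (image_row G lam X)^T
  = row (lshift k (rev_ord p)) X *m (image_row G lam X)^T.

Lemma evec_tr_mul p (X : 'M[C]_(D, n)) : (evec R k p)^T *m X = row (lshift k p) X.
Proof. by rewrite /evec trmx_delta -rowE. Qed.

Lemma skew_vec_tr_mul (c : 'I_m.+1 -> C) (X : 'M[C]_(D, n)) (x : 'cV[C]_n) :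
  (skew_vec k c)^T *m X *m x
  = \sum_p c p *: (row (lshift k (inord p)) X *m x
                   - row (lshift k (rev_ord (inord p))) X *m x).
Proof.
rewrite /skew_vec raddf_sum -mulmxA mulmx_suml; apply: eq_bigr => p _ /=.
rewrite linearZ -scalemxAl linearB mulmxBl /= !mulmxA.
by rewrite !evec_tr_mul.
Qed.

Lemma pal_rows_form_eq0 (c : 'I_m.+1 -> C) u : pal_rows (unvec (Gi *m u)) ->
  dotc (conj_mx u) (fmx_of G lam (skew_vec k c) *m u) = 0.
Proof.
move=> Xpal; rewrite dotc_conj_fmx_of // dotc_conj_row skew_vec_tr_mul big1 ?mxE ?mulr0 //.
by move=> p _; rewrite Xpal subrr scaler0.
Qed.

(** On combinations of [(u, 0)] and [(0, conj u)] the off-diagonal blocks of [F]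
    contribute nothing, and such a combination exists in every hyperplane. *)
Lemma pal_rows_lambda2 (c : 'I_m.+1 -> C) u : u != 0 -> pal_rows (unvec (Gi *m u)) ->
  sqn (image_row G lam (unvec (Gi *m u))) / sqn u <= lambda2 (Fmx_of G lam (skew_vec k c)).
Proof.
move=> u_neq0 Xpal; apply: Courant_Fischer_ge => [||e]; first exact: Fmx_of_herm.
  exact: dim_gt1.
have [a [b [ab_neq0 abE]]] :=
  kernel_pair (dotc (usubmx e) u) (dotc (dsubmx e) (conj_mx u)).
have u_gt0 : 0 < sqn u by rewrite sqn_gt0.
have sqnE : sqn (col_mx (a *: u) (b *: conj_mx u)) = (sq a + sq b) * sqn u.
  by rewrite sqn_col_mx !sqnZ sqn_conj mulrDl.
exists (col_mx (a *: u) (b *: conj_mx u)); split.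
- rewrite -sqn_gt0 sqnE mulr_gt0 // lt0r addr_ge0 ?sqr_ge0 // andbT.
  rewrite paddr_eq0 ?sqr_ge0 // !sqrf_eq0 !normc_eq0.
  by move: ab_neq0; rewrite -negb_and.
- rewrite -[e]vsubmxK dotc_col_mx !dotcZr -[RHS]abE.
  by rewrite ![_ * dotc _ _]mulrC.
rewrite sqnE /Fmx_of (qf_conj_block _ _ _ (fmx_of_sym _ lam_neq0 _)).
rewrite conj_mxZ conj_mxK !qf_scale normc_conj.
rewrite -scalemxAr dotcZl dotcZr pal_rows_form_eq0 // !mulr0 addr0 -mulrDl qf_Jmx //.
by rewrite mulrCA divfK // gt_eqF.
Qed.

End LowerBound.

Section Perturbations.
Variables (R : realType) (n d k : nat) (G : rmp R n d k) (lam : R[i]).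
Local Notation C := R[i].
Local Notation sq z := (Normc.normc z ^+ 2).
Hypotheses (n_gt0 : (0 < n)%N) (d_ge1 : (1 <= d)%N) (lam_neq0 : lam != 0).
Hypothesis G_unit : rmp_eval G lam \in unitmx.
Local Notation D := (d.+1 + k)%N.
Local Notation N := (D * n)%N.
Local Notation M := (Minv G lam).
Local Notation Lam := (Lambda G lam).
Local Notation Gi := (invmx (Gamma n d k lam)).
Local Notation m := (half_deg d).

Definition perturbed_det (T : mxtuple R n d k) : C :=
  \det (\sum_(p < d.+1) lam ^+ p *: (rA G p - T.1 p)
        + \sum_(j < k) weight G j lam *: (rE G j - T.2 j)).

Definition pert_rows (T : mxtuple R n d k) (x : 'cV[C]_n) : 'M[C]_(D, n) :=
  col_mx (\matrix_p (T.1 p *m x)^T) (\matrix_j (T.2 j *m x)^T).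

Lemma row_pert_rows_l T x p : row (lshift k p) (pert_rows T x) = (T.1 p *m x)^T.
Proof. by apply/rowP => j; rewrite mxE col_mxEu !mxE. Qed.

Lemma row_pert_rows_r T x j : row (rshift d.+1 j) (pert_rows T x) = (T.2 j *m x)^T.
Proof. by apply/rowP => i; rewrite mxE col_mxEd !mxE. Qed.

Lemma Lambda_pert_rows T x :
  (\sum_(p < d.+1) lam ^+ p *: (rA G p - T.1 p)
   + \sum_(j < k) weight G j lam *: (rE G j - T.2 j)) *m x
  = rmp_eval G lam *m x - (Lam *m pert_rows T x)^T.
Proof.
rewrite /pert_rows /Lambda mul_row_col !mulmx_sum_row.
have trD (u v : 'rV[C]_n) : (u + v)^T = u^T + v^T by exact: linearD.
have tr_sum (I : finType) (f : I -> 'rV[C]_n) : (\sum_i f i)^T = \sum_i (f i)^T.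
  exact: raddf_sum.
have trZ a (u : 'rV[C]_n) : (a *: u)^T = a *: u^T by exact: linearZ.
rewrite trD !tr_sum /rmp_eval !mulmxDl opprD addrACA !mulmx_suml -!sumrB.
by congr (_ + _); apply: eq_bigr => p _;
  rewrite trZ rowK trmxK mxE -!scalemxAl mulmxBl scalerBr.
Qed.

(** Singularity along [x] says that the rows determine [x]. *)
Lemma perturbed_det0P T : reflect (exists2 x : 'cV[C]_n, x != 0
    & rmp_eval G lam *m x = (Lam *m pert_rows T x)^T) (perturbed_det T == 0).
Proof.
rewrite /perturbed_det -det_tr; apply: (iffP det0P).
  case=> v v_neq0 vA; exists v^T.
    by rewrite -(inj_eq (@trmx_inj _ _ _)) trmxK trmx0.
  apply/eqP; rewrite -subr_eq0 -Lambda_pert_rows.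
  by rewrite -(inj_eq (@trmx_inj _ _ _)) trmx_mul trmxK vA trmx0.
case=> x x_neq0 xE; exists x^T.
  by rewrite -(inj_eq (@trmx_inj _ _ _)) trmxK trmx0.
by rewrite -trmx_mul Lambda_pert_rows xE subrr trmx0.
Qed.

Lemma tuple_norm_ge0 (T : mxtuple R n d k) : 0 <= tuple_norm T.
Proof. exact: sqrtr_ge0. Qed.

Lemma tuple_norm_sq (T : mxtuple R n d k) : tuple_norm T ^+ 2
  = \sum_p spectral_norm (T.1 p) ^+ 2 + \sum_j spectral_norm (T.2 j) ^+ 2.
Proof.
by rewrite sqr_sqrtr // addr_ge0 // sumr_ge0 // => *; exact: sqr_ge0.
Qed.

(** The rows produced by a feasible tuple, scaled by the weights, have norm at most the
    tuple norm times [|x|]. *)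
Lemma feasible_lambda2 T (c : 'I_m.+1 -> C) : @pal_T R n d k T ->
  perturbed_det T = 0 ->
  0 < tuple_norm T /\ (tuple_norm T ^+ 2)^-1 <= lambda2 (Fmx_of G lam (skew_vec k c)).
Proof.
case=> Tpal Tsym /eqP/perturbed_det0P[x x_neq0 xE].
pose X := pert_rows T x; pose u := Gamma n d k lam *m vec X.
have uX : unvec (Gi *m u) = X by rewrite /u mulKmx ?Gamma_unit // vecK.
have xiE : image_row G lam X = x^T.
  by rewrite /image_row -[Lam *m X]trmxK -xE -trmx_mul mulKmx.
have Xpal : pal_rows G lam (unvec (Gi *m u)).
  move=> p; rewrite uX xiE trmxK !row_pert_rows_l -Tpal.
  have tr11 (A : 'M[C]_1) : A^T = A by apply/matrixP => i j; rewrite !ord1 mxE.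
  by rewrite -[RHS]tr11 [in RHS]trmx_mul trmxK trmx_mul mulmxA.
have x_gt0 : 0 < sqn x by rewrite sqn_gt0.
have u_neq0 : u != 0.
  apply: contraNneq x_neq0 => u0.
  have X0 : X = 0 by rewrite -uX u0 mulmx0; apply/matrixP => i j; rewrite !mxE.
  by rewrite -(inj_eq (@trmx_inj _ _ _)) trmx0 -xiE X0 /image_row mulmx0 mul0mx.
have u_gt0 : 0 < sqn u by rewrite sqn_gt0.
have u_le : sqn u <= tuple_norm T ^+ 2 * sqn x.
  rewrite (sqn_scaled_rows lam_neq0) uX tuple_norm_sq mulrDl; apply: lerD.
    rewrite -(gammaR_average d_ge1 lam_neq0 (f := fun p => spectral_norm (T.1 p) ^+ 2)).
      rewrite mulr_suml; apply: ler_sum => p _.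
      rewrite row_pert_rows_l sqn_tr -mulrA ler_wpM2l ?sqr_ge0 //.
      exact: sqn_mulmx_spectral_norm.
    by move=> p; rewrite -Tpal spectral_norm_tr.
  rewrite mulr_suml; apply: ler_sum => j _.
  by rewrite row_pert_rows_r sqn_tr sqn_mulmx_spectral_norm.
have T_gt0 : 0 < tuple_norm T ^+ 2.
  by rewrite -(pmulr_lgt0 _ x_gt0) (lt_le_trans u_gt0).
split; first by rewrite lt0r tuple_norm_ge0 andbT -sqrf_eq0 gt_eqF.
have := pal_rows_lambda2 n_gt0 lam_neq0 c u_neq0 Xpal.
rewrite uX xiE sqn_tr; apply: le_trans.
by rewrite ler_pdivlMr // mulrC ler_pdivrMr // mulrC.
Qed.

End Perturbations.

(** * Consequences of minimality *)

Section Optimum.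
Variables (R : realType) (n d k : nat) (G : rmp R n d k) (lam : R[i]).
Local Notation C := R[i].
Local Notation conj := (@Num.conj C).
Local Notation sq z := (Normc.normc z ^+ 2).
Hypotheses (n_gt0 : (0 < n)%N) (lam_neq0 : lam != 0).
Local Notation D := (d.+1 + k)%N.
Local Notation N := (D * n)%N.
Local Notation J := (Jmx G lam).
Local Notation m := (half_deg d).

Lemma qf_Fmx_of g (y z : 'cV[C]_N) : qf (Fmx_of G lam g) (col_mx y z)
  = qf J y + qf J (conj_mx z) + 2 * complex.Re (dotc z (fmx_of G lam g *m y)).
Proof. exact: qf_conj_block (fmx_of_sym _ lam_neq0 _). Qed.

(** The two matrices are unitarily similar through [diag (1, th)]. *)
Lemma lambda2_phase (g : 'cV[C]_D) (th : C) : conj th * th = 1 ->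
  lambda2 (Fmx_of G lam (th *: g)) <= lambda2 (Fmx_of G lam g).
Proof.
move=> th1; have th2 : sq th = 1 by apply: complexI; rewrite sqC th1.
have [th' th'E] : exists th' : C, th' = conj th by exists (conj th).
have th'2 : sq th' = 1 by rewrite th'E normc_conj.
have herm := Fmx_of_herm G lam_neq0.
apply: Courant_Fischer_ge => [||e]; [exact: herm | exact: dim_gt1 |].
have [y [y_neq0 ey yF]] := Courant_Fischer_witness (herm (th *: g)) (dim_gt1 d k n_gt0)
  (lexx _) (col_mx (usubmx e) (th *: dsubmx e)).
move: y_neq0 ey yF; rewrite -[y]vsubmxK; move: (usubmx y) (dsubmx y) => y1 y2.
rewrite dotc_col_mx dotcZl -th'E => y_neq0 ey yF.
have nE : sqn (col_mx y1 (th' *: y2)) = sqn (col_mx y1 y2).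
  by rewrite !sqn_col_mx sqnZ th'2 mul1r.
have qE : qf (Fmx_of G lam g) (col_mx y1 (th' *: y2))
        = qf (Fmx_of G lam (th *: g)) (col_mx y1 y2).
  rewrite [LHS]qf_Fmx_of [RHS]qf_Fmx_of conj_mxZ qf_scale normc_conj th'2 mul1r.
  rewrite dotcZl th'E conjCK.
  by rewrite fmx_ofZ -scalemxAl dotcZr.
exists (col_mx y1 (th' *: y2)); split.
- by rewrite -sqn_eq0 nE sqn_eq0.
- by rewrite -[e]vsubmxK dotc_col_mx dotcZr.
- by rewrite nE qE.
Qed.

(** Rotating all coefficients by a common phase makes the last one real without
    changing the second eigenvalue. So a minimum over the real parameters is also one
    over all complex coefficients, and stationarity holds in the missing direction. *)
Lemma psi_min_complex (l : R) : (forall t, l <= psi G lam t) ->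
  forall c : 'I_m.+1 -> C, l <= lambda2 (Fmx_of G lam (skew_vec k c)).
Proof.
move=> lmin c.
have [th th1 thc] : exists2 th : C, conj th * th = 1 & complex.Im (th * c ord_max) = 0.
  have [c0|c_neq0] := eqVneq (c ord_max) 0.
    by exists 1; rewrite ?c0 ?mulr0 // rmorph1 mulr1.
  have nc0 : (Normc.normc (c ord_max))%:C != 0 :> C.
    by rewrite -(rmorph0 (real_complex R)) (inj_eq (@complexI _)) normc_eq0.
  (* a unit phase rotating [c ord_max] to its modulus *)
  exists (conj (c ord_max) / (Normc.normc (c ord_max))%:C).
    rewrite rmorphM /= conjCK fmorphV /= conj_real mulrACA -invfM -rmorphM /= -expr2.
    by rewrite sqC [_ * conj _]mulrC divff // mulf_neq0 ?conjC_eq0.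
  by rewrite mulrAC -sqC -fmorphV -rmorphM.
have [t tE] := coefs_surj (c := fun p => th * c p) thc.
apply: le_trans (lmin t) _; rewrite /psi FmxE (eq_skew_vec k tE) skew_vecZ.
exact: lambda2_phase.
Qed.

End Optimum.

Section Stationary.
Variables (R : realType) (n d k : nat) (G : rmp R n d k) (lam : R[i]).
Local Notation C := R[i].
Local Notation conj := (@Num.conj C).
Hypotheses (n_gt0 : (0 < n)%N) (d_ge1 : (1 <= d)%N) (lam_neq0 : lam != 0).
Local Notation D := (d.+1 + k)%N.
Local Notation N := (D * n)%N.
Local Notation J := (Jmx G lam).
Local Notation Gi := (invmx (Gamma n d k lam)).
Local Notation m := (half_deg d).

Variables (t : 'rV[R]_(m.*2.+1)) (l : R).
Hypothesis lE : psi G lam t = l.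
Hypothesis lmin : forall t', l <= psi G lam t'.
Hypothesis simple : simple_eigenvalue (Fmx G lam t) l%:C.
Local Notation f := (fmx_of G lam (skew_vec k (coefs t))).

Lemma optimal_eigenvector : exists2 u : 'cV[C]_N, u != 0 &
  J *m u + conj_mx f *m conj_mx u = l%:C *: u.
Proof.
have l_in : l%:C \in eigenvalues (Fmx_of G lam (skew_vec k (coefs t))).
  by rewrite -has_pred1 has_count -FmxE // simple.
have [w w_neq0 Fw] := eigenvector_of_eigenvalue (Fmx_of_herm G lam_neq0 _) l_in.
exact: conj_swap_eigenvector w_neq0 Fw.
Qed.

Lemma Fmx_of_step (c : 'I_m.+1 -> C) (eps : R) :
  Fmx_of G lam (skew_vec k (coefs t)) + eps%:C *: conj_block 0 (fmx_of G lam (skew_vec k c))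
  = Fmx_of G lam (skew_vec k (fun p => coefs t p + eps%:C * c p)).
Proof.
transitivity (conj_block (J + eps%:C *: 0)
                (fmx_of G lam (skew_vec k (coefs t))
                 + eps%:C *: fmx_of G lam (skew_vec k c))).
  by rewrite conj_blockZ; exact: conj_blockD.
by rewrite scaler0 addr0 -fmx_ofZ -fmx_ofD -skew_vecZ -skew_vecD.
Qed.

Variable u : 'cV[C]_N.
Hypothesis uE : J *m u + conj_mx f *m conj_mx u = l%:C *: u.

(** Stationarity in the direction of the coefficients [c]. *)
Lemma optimal_form_Re_ge0 (c : 'I_m.+1 -> C) :
  0 <= complex.Re (dotc (conj_mx u) (fmx_of G lam (skew_vec k c) *m u)).
Proof.
have lE' : lambda2 (Fmx_of G lam (skew_vec k (coefs t))) = l by rewrite -FmxE.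
have sym := fmx_of_sym G lam_neq0 (skew_vec k c).
rewrite -(pmulr_rge0 _ (ltr0n R 2)) -(qf_conj_block0 u sym).
apply: (simple_lambda2_first_order (F := Fmx_of G lam (skew_vec k (coefs t)))).
- exact: Fmx_of_herm.
- by apply: conj_block_herm; [exact: adj_mx0 | exact: sym].
- exact: dim_gt1.
- by rewrite lE' -FmxE.
- by rewrite lE'; exact: conj_block_mul_conj.
by move=> eps _; rewrite lE' Fmx_of_step; exact: psi_min_complex.
Qed.

Lemma optimal_form_eq0 (c : 'I_m.+1 -> C) :
  dotc (conj_mx u) (fmx_of G lam (skew_vec k c) *m u) = 0.
Proof.
set a := dotc _ _.
(* this choice turns the form into minus the squared modulus of [a] *)
have := optimal_form_Re_ge0 (fun p => - conj a * c p).
rewrite skew_vecZ fmx_ofZ -scalemxAl dotcZr -/a mulNr -sqC cReN /= oppr_ge0 => a0.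
by apply/eqP; rewrite -normc_eq0 -sqrf_eq0 eq_le a0 sqr_ge0.
Qed.

Local Notation X := (unvec (Gi *m u)).
Local Notation xr := (image_row G lam X).

(** Pairing the eigenvector equation with [u], the off-diagonal term drops out and
    leaves [|x|^2 = u^H J u]. *)
Lemma optimal_sqn : sqn xr = l * sqn u.
Proof.
rewrite -qf_Jmx //; apply: complexI; rewrite /qf.
have -> : J *m u = l%:C *: u - conj_mx f *m conj_mx u by rewrite -uE addrK.
have -> : dotc u (l%:C *: u - conj_mx f *m conj_mx u) = (l * sqn u)%:C.
  rewrite -scaleN1r dotcDr !dotcZr dotcc -[u in dotc u (_ *m _)]conj_mxK.
  by rewrite -conj_mxM dotc_conj_mx optimal_form_eq0 rmorph0 mulr0 addr0 rmorphM.
by [].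
Qed.

Lemma optimal_pal_rows : pal_rows G lam X.
Proof.
have base (j : 'I_m.+1) : row (lshift k (inord j)) X *m xr^T
    = row (lshift k (rev_ord (inord j))) X *m xr^T.
  have := optimal_form_eq0 (fun p => (p == j)%:R).
  rewrite dotc_conj_fmx_of // dotc_conj_row skew_vec_tr_mul.
  rewrite (bigD1 j) //= big1 => [|i /negPf ->].
    rewrite eqxx scale1r addr0 => /eqP; rewrite mulf_eq0 pnatr_eq0 /= => /eqP E.
    by apply/eqP; rewrite -subr_eq0; apply/eqP/matrixP => a b; rewrite !ord1 E mxE.
  by rewrite scale0r.
move=> p; have [[j [->|pj]]|->] := palindromic_index d_ge1 p; rewrite ?base //.
by rewrite -[p]rev_ordK pj rev_ordK base.
Qed.

End Stationary.

(** * An optimal palindromic perturbation *)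

Section Construction.
Variables (R : realType) (n d k : nat) (G : rmp R n d k) (lam : R[i]).
Local Notation C := R[i].
Local Notation conj := (@Num.conj C).
Hypotheses (d_ge1 : (1 <= d)%N) (lam_neq0 : lam != 0).
Hypothesis w_neq0 : forall j : 'I_k, weight G j lam != 0.
Hypothesis G_unit : rmp_eval G lam \in unitmx.
Local Notation D := (d.+1 + k)%N.
Local Notation N := (D * n)%N.
Local Notation M := (Minv G lam).
Local Notation Lam := (Lambda G lam).
Local Notation J := (Jmx G lam).
Local Notation Gi := (invmx (Gamma n d k lam)).
Local Notation m := (half_deg d).
Local Notation block_scale := (@block_scale R d k lam).

Variables (g : 'cV[C]_D) (l : R) (u : 'cV[C]_N).
Hypothesis l_gt0 : 0 < l.
Hypothesis u_neq0 : u != 0.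
Hypothesis uE :
  J *m u + conj_mx (fmx_of G lam g) *m conj_mx u = l%:C *: u.
Local Notation X := (unvec (Gi *m u)).
Local Notation xr := (image_row G lam X).
Local Notation x := (xr^T).
Hypothesis X_pal : pal_rows G lam X.
Hypothesis x_sqn : sqn xr = l * sqn u.

Let x_neq0 : x != 0.
Proof. by rewrite -sqn_gt0 sqn_tr x_sqn mulr_gt0 // sqn_gt0. Qed.

Let den (q : 'I_D) : C := (l * block_scale q ^+ 2)%:C.

Let den_neq0 q : den q != 0.
Proof.
rewrite -(rmorph0 (real_complex R)) (inj_eq (@complexI _)).
by rewrite mulf_neq0 ?gt_eqF // exprn_gt0 // block_scale_gt0.
Qed.

Lemma row_outer p (v : 'cV[C]_p) (w : 'rV[C]_n) q : row q (v *m w) = v q 0 *: w.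
Proof. by apply/rowP => j; rewrite !mxE big_ord1. Qed.

(** Row [q] of the eigenvector equation once the scaling by [Gamma] is undone, which
    leaves the factor [l gamma_q^2]. *)
Lemma eigen_row q :
  conj (Lam 0 q) *: (xr *m conj_mx M + conj_mx (g^T *m X *m M))
  + conj (g q 0) *: conj_mx xr = den q *: row q X.
Proof.
have unvec_u : unvec u = \matrix_q ((block_scale q)%:C *: row q X).
  apply/row_matrixP => q'; rewrite rowK unvec_invGamma // row_block_scale_inv scalerA.
  by rewrite -rmorphM /= divff ?scale1r // gt_eqF // block_scale_gt0.
have := congr1 (fun v => row q (unvec v)) uE.
rewrite unvecD unvecZ unvec_Jmx // -conj_mxM unvec_conj unvec_fmx_of //.
have rowD (A B : 'M[C]_(D, n)) : row q (A + B) = row q A + row q B.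
  exact: linearD.
have rowZ a (A : 'M[C]_(D, n)) : row q (a *: A) = a *: row q A.
  exact: linearZ.
have row_conj (A : 'M[C]_(D, n)) : row q (conj_mx A) = conj_mx (row q A).
  by apply/rowP => j; rewrite !mxE.
have LamT : Lam^T q 0 = Lam 0 q by rewrite [LHS]mxE.
rewrite rowD rowZ row_conj !row_block_scale_inv rowD !row_outer unvec_u rowK.
rewrite conj_mxZ conj_real -scalerDr conj_mxD !conj_mxZ adj_mxE LamT => E.
have : (block_scale q)%:C *: (l%:C *: ((block_scale q)%:C *: row q X)) = den q *: row q X.
  by rewrite !scalerA /den -!rmorphM /= mulrCA mulrA.
rewrite -E scalerA -rmorphM /= divff ?gt_eqF ?block_scale_gt0 // scale1r => <-.
by rewrite scalerDr -addrA; congr (_ + _); rewrite addrC.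
Qed.

Let zt : 'rV[C]_n := xr *m conj_mx M + conj_mx (g^T *m X *m M).
Let s : C := (zt *m x) 0 0 / (sqn x)%:C.
Let h : 'cV[C]_n := zt^T - s *: conj_mx x.
Let b (q : 'I_D) : C := conj (Lam 0 q) / den q.
Let a (q : 'I_D) : C := conj (g q 0) / den q + b q * s.

Lemma tr_conj_mul (v : 'cV[C]_n) : (conj_mx v)^T *m v = (sqn v)%:C%:M.
Proof. by rewrite [LHS]mx11_scalar -trace_mx11 -dotcc. Qed.

Let hx : h^T *m x = 0.
Proof.
have -> : h^T = zt - s *: (conj_mx x)^T.
  by rewrite /h; apply/rowP => j; rewrite !mxE.
rewrite mulmxBl -scalemxAl tr_conj_mul scale_scalar_mx /s divfK.
  by rewrite -mx11_scalar subrr.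
by rewrite -(rmorph0 (real_complex R)) (inj_eq (@complexI _)) sqn_eq0.
Qed.

(** Up to scaling, the eigenvector equation puts all rows in the plane of [conj x] and
    [zt]; [h] is the part of [zt] orthogonal to [conj x]. *)
Lemma rows_decomp q : (row q X)^T = a q *: conj_mx x + b q *: h.
Proof.
have -> : row q X = (den q)^-1 *: (conj (Lam 0 q) *: zt + conj (g q 0) *: conj_mx xr).
  by rewrite eigen_row scalerA mulVf ?scale1r.
rewrite /a /b /h conj_mx_tr; move: zt (conj_mx xr) (den q) => z y e.
apply/colP => j; rewrite !mxE; move: (conj (Lam 0 q)) (conj (g q 0)) s (z 0 j) (y 0 j) e^-1.
move=> *; ring.
Qed.

Lemma rows_dot q : row q X *m x = (a q * (sqn x)%:C)%:M.
Proof.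
have -> : row q X = (a q *: conj_mx x + b q *: h)^T by rewrite -rows_decomp trmxK.
have -> : (a q *: conj_mx x + b q *: h)^T = a q *: (conj_mx x)^T + b q *: h^T.
  by apply/rowP => j; rewrite !mxE.
rewrite mulmxDl -!scalemxAl hx tr_conj_mul scaler0 addr0 scale_scalar_mx //.
Qed.

Let a_rev p : a (lshift k (rev_ord p)) = a (lshift k p).
Proof.
have := X_pal p; rewrite !rows_dot => /matrixP/(_ 0 0).
rewrite !mxE eqxx !mulr1n => /esym /mulIf -> //.
by rewrite -(rmorph0 (real_complex R)) (inj_eq (@complexI _)) sqn_eq0.
Qed.

Let b_neq0 q : b q != 0.
Proof.
rewrite mulf_neq0 ?invr_eq0 // conjC_eq0.
case: (split_ordP q) => i ->; first by rewrite LamE_lshift expf_neq0.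
by rewrite row_mxEr mxE.
Qed.

(** The weights are chosen so that [|Lambda_q| / gamma_q^2] agrees on [p] and [d - p]. *)
Let b_rev p : Normc.normc (b (lshift k p)) = Normc.normc (b (lshift k (rev_ord p))).
Proof.
rewrite /b !Normc.normcM !Normc.normcV !normc_conj !LamE_lshift /den !normc_real.
rewrite !block_scale_lshift.
have normX j : Normc.normc (lam ^+ j) = Normc.normc lam ^+ j.
  by elim: j => [|j IH]; rewrite ?expr0 ?normc_real ?normr1 // !exprS Normc.normcM IH.
have g_gt0 q : 0 < l * gammaR lam q ^+ 2 by rewrite mulr_gt0 // exprn_gt0 // gammaR_gt0.
have [_ E] := gammaR_sq_rev d_ge1 lam_neq0 p.
rewrite !normX !gtr0_norm //; apply/eqP.
rewrite eqr_div; [|by rewrite gt_eqF..].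
by rewrite mulrCA [_ ^+ p * _]mulrC E [eqbRHS]mulrCA [_ ^+ rev_ord p * _]mulrC.
Qed.

(** The formula is uniform in [p]: since the coefficients [a] agree on [p] and [d - p],
    transposition exchanges the two matrices of a pair, and a middle index gives a
    symmetric matrix. *)
Definition optimal_tuple : mxtuple R n d k :=
  (fun p => pal_map x h (a (lshift k p)) (b (lshift k p)) (b (lshift k (rev_ord p))),
   fun j => let q := rshift d.+1 j in pal_map x h (a q) (b q) (b q)).

Lemma optimal_tuple_pal : @pal_T R n d k optimal_tuple.
Proof.
split=> [p|j]; last exact: pal_map_tr (b_neq0 _) _.
apply: etrans (pal_map_tr _ _ _ (b_neq0 _) (b_rev p)) _.
by rewrite /optimal_tuple /= rev_ordK a_rev.
Qed.

Lemma optimal_tuple_rows : pert_rows optimal_tuple x = X.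
Proof.
apply/row_matrixP => q; case: (split_ordP q) => i ->.
  by rewrite row_pert_rows_l /= pal_map_apply // -rows_decomp trmxK.
by rewrite row_pert_rows_r /= pal_map_apply // -rows_decomp trmxK.
Qed.

Lemma optimal_tuple_det : perturbed_det G lam optimal_tuple = 0.
Proof.
apply/eqP/perturbed_det0P; exists x => //; rewrite optimal_tuple_rows.
rewrite -[X in X *m _]trmxK -trmx_mul; congr (_^T).
have MM : M^T *m (rmp_eval G lam)^T = 1%:M by rewrite -trmx_mul mulmxV // trmx1.
by rewrite /image_row -[LHS]mulmxA MM mulmx1.
Qed.

Lemma optimal_tuple_norm : tuple_norm optimal_tuple <= (Num.sqrt l)^-1.
Proof.
have x_gt0 : 0 < sqn x by rewrite sqn_gt0.
have nu q c : c = b q \/ (exists2 p, q = lshift k p & c = b (lshift k (rev_ord p))) ->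
  spectral_norm (pal_map x h (a q) (b q) c) ^+ 2 <= sqn (row q X) / sqn x.
  move=> cq; have bc : Normc.normc (b q) = Normc.normc c.
    by case: cq => [->|[p -> ->]] //; exact: b_rev.
  have := pal_map_spectral_norm x_neq0 hx (a q) (b_neq0 q) bc.
  rewrite -rows_decomp sqn_tr => le.
  rewrite -[leRHS]sqr_sqrtr ?divr_ge0 ?sqn_ge0 //.
  by rewrite lerXn2r ?nnegrE ?sqrtr_ge0 ?spectral_norm_ge0.
rewrite /tuple_norm -(sqrtrV (ltW l_gt0)) ler_sqrt ?invr_ge0 ?(ltW l_gt0) //.
have -> : l^-1 = sqn u / sqn x.
  by rewrite sqn_tr x_sqn invfM mulrCA divff ?mulr1 // gt_eqF ?sqn_gt0.
rewrite (sqn_scaled_rows lam_neq0) (gammaR_average d_ge1 lam_neq0) => [|p]; last first.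
  rewrite -[LHS]sqn_tr -[RHS]sqn_tr !rows_decomp !sqn_conj_orthogonal //.
  by rewrite a_rev -b_rev.
rewrite mulrDl !mulr_suml; apply: lerD; apply: ler_sum => i _; apply: nu.
  by right; exists i.
by left.
Qed.

End Construction.

(** * The theorem *)

Unset Implicit Arguments.
Set Strict Implicit.

Theorem theorem6p3 (R : realType) (n d k : nat) (G : rmp R n d k) (lam : R[i])
    (n_gt0 : (0 < n)%N) (d_ge1 : (1 <= d)%N)
    (G_pal : T_palindromic G)
    (lam_neq0 : lam != 0) (lam_neq1 : lam != 1) (lam_neqN1 : lam != -1)
    (lam_npole : ~ is_pole G lam)
    (w_neq0 : forall j : 'I_k, weight G j lam != 0)
    (G_unit : rmp_eval G lam \in unitmx) :
  exists lam2 : R,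
    [/\ (exists t, psi G lam t = lam2) /\ (forall t, lam2 <= psi G lam t),
        0 < lam2,
        (((Num.sqrt lam2)^-1)%:E <= backward_error_pal_T G lam)%E
      & forall t, psi G lam t = lam2 ->
          simple_eigenvalue (Fmx G lam t) lam2%:C ->
          backward_error_pal_T G lam = ((Num.sqrt lam2)^-1)%:E].
Proof.
have [t0 t0min] := psi_min n_gt0 d_ge1 lam_neq0 lam_neq1 lam_neqN1 G_unit.
have bound T : @pal_T R n d k T -> perturbed_det G lam T = 0 ->
    0 < tuple_norm T /\ (tuple_norm T ^+ 2)^-1 <= psi G lam t0.
  move=> Tpal Tdet; rewrite /psi FmxE //.
  exact: feasible_lambda2.
(* the coefficients of [G] are themselves a feasible perturbation *)
have l_gt0 : 0 < psi G lam t0.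
  case: (bound (rA G, rE G)).
  - by case: G_pal.
  - rewrite /perturbed_det !big1 ?addr0 => [|i _|i _]; rewrite ?subrr ?scaler0 //.
    by case: (n) n_gt0 => // n' _; exact: det0.
  - move=> T_gt0; apply: lt_le_trans.
    by rewrite invr_gt0 exprn_gt0.
have lower : (((Num.sqrt (psi G lam t0))^-1)%:E <= backward_error_pal_T G lam)%E.
  apply/ereal_infP => _ [T [Tpal Tdet] <-]; rewrite lee_fin.
  case: (bound T Tpal Tdet); move: (tuple_norm T) => N T_gt0 le_l.
  rewrite -[N]invrK lef_pV2 ?posrE ?invr_gt0 ?sqrtr_gt0 //.
  rewrite -(@ler_pXn2r _ 2) ?nnegrE ?invr_ge0 ?sqrtr_ge0 ?(ltW T_gt0) //.
  by rewrite sqr_sqrtr ?(ltW l_gt0) // exprVn.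
exists (psi G lam t0); split; [|exact: l_gt0|exact: lower|].
  by split; [exists t0 | exact: t0min].
move=> t tE simple; apply: le_anti; apply/andP; split; last exact: lower.
have [u u_neq0 uE] := optimal_eigenvector lam_neq0 simple.
have X_pal := optimal_pal_rows n_gt0 d_ge1 lam_neq0 tE t0min simple uE.
have x_sqn := optimal_sqn n_gt0 lam_neq0 tE t0min simple uE.
apply: ge_ereal_inf.
have T_pal := optimal_tuple_pal d_ge1 lam_neq0 w_neq0 l_gt0 u_neq0 uE X_pal x_sqn.
have T_det := optimal_tuple_det lam_neq0 G_unit l_gt0 u_neq0 uE x_sqn.
have T_norm := optimal_tuple_norm d_ge1 lam_neq0 w_neq0 l_gt0 u_neq0 uE X_pal x_sqn.
by eexists; [eexists; [split; [exact: T_pal | exact: T_det] | reflexivity]|].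
Qed.
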